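(* Let $F$ be a double-well potential satisfying the standing assumptions listed in the context, with $F(x_0)<F(x_1)$. For each $\varepsilon>0$ let $(\xi_0,\xi_1)=(\xi_{0,\varepsilon},\xi_{1,\varepsilon})$ be an admissible pair and let $(X,Y)=(X_\varepsilon,Y_\varepsilon)$ be the corresponding coupled process. Then the following three conditions are equivalent: (1) $P(X_\varepsilon(t)>0\mid Y_\varepsilon(t)=1)\to 1$ as $\varepsilon\to0$, for each $t\ge 0$. (a) $\xi_1\sim|\eta(-\infty)|^{-1}$ as $\varepsilon\to0$. (b) $E[g(X(t))\mid Y(t)=1]-E^{\varpi}[g(X(0))\mid X(0)>0]\to0$ as $\varepsilon\to0$, for each $t\ge0$ and each bounded, measurable $g:\mathbb{R}\to\mathbb{R}$ that is continuous at $x_0$ and $x_1$. Moreover, (1) implies that $P(X_\varepsilon(t)<0\mid Y_\varepsilon(t)=0)\to 1$ as $\varepsilon\to0$, for each $t\ge0$.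
   Context: Notation: $a_\varepsilon\sim b_\varepsilon$ means $a_\varepsilon/b_\varepsilon\to1$ as $\varepsilon\to0$. Standing assumptions on $F$: $F\in C^3(\mathbb{R})$, $F(x)\to\infty$ as $|x|\to\infty$; there are constants $a_1,a_2,c_1,c_2,c_3,c_4>0$ with $a_2<2a_1-2$ such that for all $x$, $c_1|x|^{a_1}-c_2\le |F'(x)|^2\le c_3|x|^{a_2}+c_4$ and $c_1|x|^{a_1}-c_2\le(|F'(x)|-2F''(x))^2\le c_3|x|^{a_2}+c_4$. There are points $x_0<0<x_1$ such that $F$ is strictly decreasing on $(-\infty,x_0)$ and $(0,x_1)$, strictly increasing on $(x_0,0)$ and $(x_1,\infty)$, $F''(x_0)>0$, $F''(0)<0$, $F''(x_1)>0$, and $F(x_0)<F(x_1)$. Eigenfunction: for each $\varepsilon>0$ put $\mu(dx)=e^{-F(x)/\varepsilon}dx$, $\varpi=\mu(\mathbb{R})^{-1}\mu$, and $Af=\varepsilon f''-F'f'$. Let $-\lambda=-\lambda_\varepsilon<0$ be the second eigenvalue of $A$ in $L^2(\varpi)$ (the first is $0$, with constant eigenfunctions) and $\eta=\eta_\varepsilon$ a corresponding eigenfunction, so $\varepsilon\eta''-F'\eta'=-\lambda\eta$. It is known that $\eta$ is continuous and bounded and, with the sign of $\eta$ suitably fixed, there is $r_\varepsilon\in\mathbb{R}$ with $\eta<0$ on $(-\infty,r_\varepsilon)$, $\eta(r_\varepsilon)=0$, $\eta>0$ on $(r_\varepsilon,\infty)$, and $\eta$ is strictly increasing. Write $\eta(\pm\infty)=\lim_{x\to\pm\infty}\eta(x)$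 (finite). Coupling: a pair $(\xi_0,\xi_1)\in\mathbb{R}^2$ (depending on $\varepsilon$) is admissible if $-1/\eta(\infty)\le\xi_j\le1/|\eta(-\infty)|$ for $j=0,1$ and $\xi_0\xi_1<0$. Given an admissible pair set $a_j=\lambda\xi_j/(\xi_j-\xi_{1-j})>0$, $Q=\begin{pmatrix} -a_0 & a_0 \\ a_1 & -a_1 \end{pmatrix}$ (rows and columns indexed by $0,1$), and $\alpha_j=1+\xi_j\eta>0$. Choose any probability vector $p=(p_0,p_1)$, and let $(X_\varepsilon,Y_\varepsilon)$ be the cadlag Markov process on $\mathbb{R}\times\{0,1\}$ with initial distribution $\nu(\Gamma\times\{i\})=p_i\int_\Gamma\alpha_i\,d\varpi$ and generator $Bf(x,i)=Af(\cdot,i)(x)+\sum_{j\ne i}Q_{ij}\frac{\alpha_j(x)}{\alpha_i(x)}(f(x,j)-f(x,i))$. It is known that $X_\varepsilon$ solves $X_\varepsilon(t)=X_\varepsilon(0)-\int_0^tF'(X_\varepsilon(s))ds+\sqrt{2\varepsilon}\,W(t)$ with $W$ a standard Brownian motion, that $Y_\varepsilon$ is a continuous-time Markov chain with generator $Q$, and that $P(X_\varepsilon(t)\in\Gamma\mid Y_\varepsilon(t)=j)=\int_\Gamma\alpha_j\,d\varpi=\varpi(\Gamma)+\xi_j\int_\Gamma\eta\,d\varpi$ for all $t\ge0$, $j\in\{0,1\}$ and Borel $\Gamma\subset\mathbb{R}$ (this formula is taken as the meaning of the conditional law if $P(Y_\varepsilon(t)=j)=0$). $E^\varpi$ denotes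 expectation when $X(0)$ has law $\varpi$. Dependence on $\varepsilon$ is suppressed in the notation. *)

(* Defs.v *)
From HB Require Import structures.
From mathcomp Require Export all_boot all_order all_algebra.
From mathcomp Require Export all_classical all_reals all_analysis.
From mathcomp Require Export measurable_realfun.
Set Implicit Arguments.
Unset Strict Implicit.
Unset Printing Implicit Defensive.
Export Order.TTheory GRing.Theory Num.Theory.
Export numFieldNormedType.Exports.
Local Open Scope classical_set_scope.
Local Open Scope ring_scope.

Definition C2 (R : realType) (f : R -> R) : Prop :=
  (forall k x, (k < 2)%N -> derivable (f^`(k)%classic) x 1) /\
  continuous (f^`(2)%classic).

Definition C3 (R : realType) (f : R -> R) : Prop :=
  (forall k x, (k < 3)%N -> derivable (f^`(k)%classic) x 1) /\
  continuous (f^`(3)%classic).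

Definition polynomially_bounded (R : realType) (a1 a2 c1 c2 c3 c4 : R)
    (h : R -> R) : Prop :=
  forall x, c1 * `|x| `^ a1 - c2 <= h x <= c3 * `|x| `^ a2 + c4.

Record double_well (R : realType) (F : R -> R) (x0 x1 : R) : Prop := {
  dw_C3 : C3 F ;
  dw_pinfty : F x @[x --> +oo] --> +oo ;
  dw_ninfty : F x @[x --> -oo] --> +oo ;
  dw_growth : exists a1 a2 c1 c2 c3 c4 : R,
    [/\ 0 < a1, 0 < a2 & a2 < 2 * a1 - 2] /\
    [/\ 0 < c1, 0 < c2, 0 < c3 & 0 < c4] /\
    polynomially_bounded a1 a2 c1 c2 c3 c4 (fun x => `|F^`()%classic x| ^+ 2) /\
    polynomially_bounded a1 a2 c1 c2 c3 c4
      (fun x => (`|F^`()%classic x| - 2 * F^`(2)%classic x) ^+ 2) ;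
  dw_x0_lt0 : x0 < 0 ;
  dw_x1_gt0 : 0 < x1 ;
  dw_decr_left : {in `]-oo, x0[ &, {homo F : x y / x < y >-> y < x}} ;
  dw_incr_left : {in `]x0, 0[ &, {homo F : x y / x < y}} ;
  dw_decr_right : {in `]0, x1[ &, {homo F : x y / x < y >-> y < x}} ;
  dw_incr_right : {in `]x1, +oo[ &, {homo F : x y / x < y}} ;
  dw_F2x0 : 0 < F^`(2)%classic x0 ;
  dw_F20 : F^`(2)%classic 0 < 0 ;
  dw_F2x1 : 0 < F^`(2)%classic x1 ;
  dw_deeper : F x0 < F x1
}.

Section gibbs.
Context (R : realType) (F : continuousType R R) (eps : R).

Definition gibbs_weight (x : R) : R := expR (- F x / eps).

Definition gibbs (A : set (measurableTypeR R)) : \bar R :=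
  (\int[lebesgue_measure]_(x in A) (gibbs_weight x)%:E)%E.

Let gibbs0 : gibbs set0 = 0%E.
Proof. by rewrite /gibbs integral_set0. Qed.

Let gibbs_ge0 A : (0 <= gibbs A)%E.
Proof. by apply: integral_ge0 => x _; rewrite lee_fin expR_ge0. Qed.

Let gibbs_sigma_additive : semi_sigma_additive gibbs.
Proof.
apply: semi_sigma_additive_nng_induced => [|x]; last first.
  by rewrite lee_fin expR_ge0.
apply/measurable_EFinP; apply: continuous_measurable_fun => x.
apply: (@continuous_comp _ _ _ (fun y => - F y / eps) expR); last first.
  exact: continuous_expR.
apply: cvgM; last exact: cvg_cst.
by apply: cvgN; exact: cts_fun.
Qed.

HB.instance Definition _ := isMeasure.Build _ _ _ gibbs
  gibbs0 gibbs_ge0 gibbs_sigma_additive.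

(* [mnormalize] needs a default probability in case the total mass is 0 or
   infinite; neither occurs for a double well and eps > 0. *)
Definition varpi : probability (measurableTypeR R) R :=
  mnormalize gibbs \d_(0 : measurableTypeR R).

End gibbs.

Definition diffusion (R : realType) (F : R -> R) (eps : R) (f : R -> R) (x : R)
  : R := eps * f^`(2)%classic x - F^`()%classic x * f^`()%classic x.

(* Eigenfunctions of A in L^2(varpi).  The coefficients of A are continuous, so
   an eigenfunction may be taken to be a classical solution.  Both endpoints are
   of limit-point type, so that every classical solution in L^2(varpi) is in the
   domain of the self-adjoint operator. *)
Definition eigenfunction (R : realType) (F : continuousType R R) (eps kappa : R)
    (f : R -> R) : Prop :=
  [/\ C2 f, (f : measurableTypeR R -> R) \in Lfun (varpi F eps) 2%:E,
      exists x, f x != 0 &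
      forall x, diffusion F eps f x = kappa * f x].

Definition eigenvalue (R : realType) (F : continuousType R R) (eps kappa : R)
  : Prop := exists f, eigenfunction F eps kappa f.

Definition second_eigenvalue (R : realType) (F : continuousType R R)
    (eps kappa : R) : Prop :=
  [/\ kappa < 0, eigenvalue F eps kappa &
      forall kappa', eigenvalue F eps kappa' -> kappa' = 0 \/ kappa' <= kappa].

(* The choice of sign of the second eigenfunction, together with the boundedness
   and monotonicity that such an eigenfunction is known to have. *)
Definition increasing_sign_change (R : realType) (eta : R -> R) : Prop :=
  [/\ bounded_fun eta, {homo eta : x y / x < y} &
      exists r, [/\ forall x, x < r -> eta x < 0, eta r = 0 &
                    forall x, r < x -> 0 < eta x]].

Definition at_pinfty (R : realType) (eta : R -> R) : R :=
  lim (eta x @[x --> +oo]).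
Definition at_ninfty (R : realType) (eta : R -> R) : R :=
  lim (eta x @[x --> -oo]).

(* The two states of the chain, 0 and 1, are [false] and [true]. *)
Definition admissible (R : realType) (eta : R -> R) (xi : bool -> R) : Prop :=
  (forall j, - (at_pinfty eta)^-1 <= xi j <= `|at_ninfty eta|^-1) /\
  xi false * xi true < 0.

Definition jump_rate (R : realType) (lambda : R) (xi : bool -> R) (j : bool)
  : R := lambda * xi j / (xi j - xi (~~ j)).

Definition Qmatrix (R : realType) (lambda : R) (xi : bool -> R) (i j : bool)
  : R := if i == j then - jump_rate lambda xi i else jump_rate lambda xi i.

Definition alpha (R : realType) (eta : R -> R) (xi : bool -> R) (j : bool)
    (x : R) : R := 1 + xi j * eta x.

Definition coupled_generator (R : realType) (F : R -> R) (eps lambda : R)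
    (eta : R -> R) (xi : bool -> R) (f : measurableTypeR R * bool -> R)
    (z : measurableTypeR R * bool) : R :=
  diffusion F eps (fun x => f (x, z.2)) z.1 +
  \sum_(j | j != z.2) Qmatrix lambda xi z.2 j *
    (alpha eta xi j z.1 / alpha eta xi z.2 z.1) * (f (z.1, j) - f z).

Definition C2_compact_support (R : realType)
    (f : measurableTypeR R * bool -> R) : Prop :=
  forall i, C2 (fun x : R => f (x, i)) /\
    exists M, forall x : R, M < `|x| -> f (x, i) = 0.

Definition cadlag (R : realType) (T : topologicalType) (z : R -> T) : Prop :=
  (forall t : R, 0 <= t -> z s @[s --> t^'+] --> z t) /\
  (forall t : R, 0 < t -> exists l : T, z s @[s --> t^'-] --> l).

Definition history (R : realType) d' d (Omega : measurableType d')
    (E : measurableType d) (Z : R -> Omega -> E) (t : R) : set (set Omega) :=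
  <<s [set A | exists s C, [/\ 0 <= s <= t, measurable C & A = Z s @^-1` C]] >>.

(* The kernel maps (t, z) to the law at time t of the process started at z; it
   is a single kernel on R * E, to have joint measurability in time and space.
   Only times t >= 0 are meaningful. *)
Definition transition_kernel (R : realType) d (E : measurableType d)
    (K : R.-pker (measurableTypeR R * E) ~> E) : Prop :=
  (forall z C, measurable C -> K (0, z) C = \d_z C) /\
  (forall (s t : R) z C, 0 <= s -> 0 <= t -> measurable C ->
     K (s + t, z) C = (\int[K (s, z)]_w K (t, w) C)%E).

Definition markov_process (R : realType) d' d (Omega : measurableType d')
    (P : probability Omega R) (E : measurableType d) (Z : R -> Omega -> E)
    (K : R.-pker (measurableTypeR R * E) ~> E) : Prop :=
  (forall t : R, 0 <= t -> measurable_fun setT (Z t)) /\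
  (forall (s t : R) C A, 0 <= s -> 0 <= t -> measurable C -> history Z s A ->
     P (A `&` Z (s + t) @^-1` C) = (\int[P]_(w in A) K (t, Z s w) C)%E).

(* The transition semigroup T_t f(z) = \int f dK(t, z) satisfies
   T_t f - f = \int_0^t T_s (B f) ds for f in D: the pairs (f, B f), f in D,
   belong to its full generator. *)
Definition has_generator (R : realType) d (E : measurableType d)
    (K : R.-pker (measurableTypeR R * E) ~> E)
    (D : set (E -> R)) (B : (E -> R) -> E -> R) : Prop :=
  forall f z (t : R), D f -> 0 <= t ->
    \int[K (t, z)]_w f w - f z =
    \int[lebesgue_measure]_(s in `[0, t]) (\int[K (s, z)]_w B f w).

Definition coupled_process (R : realType) (F : continuousType R R)
    (eps lambda : R) (eta : R -> R) (xi p : bool -> R)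
    d' (Omega : measurableType d') (P : probability Omega R)
    (X : R -> Omega -> R) (Y : R -> Omega -> bool) : Prop :=
  let Z t w : measurableTypeR R * bool := (X t w, Y t w) in
  [/\ forall w, cadlag (X ^~ w) /\ cadlag (Y ^~ w),
      forall (G : set (measurableTypeR R)) i, measurable G ->
        P (X 0 @^-1` G `&` Y 0 @^-1` [set i]) =
        (p i * \int[varpi F eps]_(x in G) alpha eta xi i x)%:E &
      exists K : R.-pker (measurableTypeR R * (measurableTypeR R * bool)) ~>
                 (measurableTypeR R * bool)%type,
        [/\ transition_kernel K, markov_process P Z K &
            has_generator K (@C2_compact_support R)
              (coupled_generator F eps lambda eta xi)]].

(* Conditioning X on the event H; when P H = 0 the conditional law is taken to
   be a d(w). *)

Section conditional.
Context (R : realType) (w : probability (measurableTypeR R) R) (a : R -> R).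
Context d (Omega : measurableType d) (P : probability Omega R).
Context (X : Omega -> R) (H : set Omega).

Definition cond_prob (G : set (measurableTypeR R)) : R :=
  if P H == 0%E then \int[w]_(x in G) a x
  else fine (P (X @^-1` G `&` H)) / fine (P H).

Definition cond_expectation (g : R -> R) : R :=
  if P H == 0%E then \int[w]_x (g x * a x)
  else (\int[P]_(o in H) g (X o)) / fine (P H).

End conditional.

(* Main.v *)
Require Import Defs.
From mathcomp Require Import ring lra.
Set Implicit Arguments.
Unset Strict Implicit.
Unset Printing Implicit Defensive.
Local Open Scope classical_set_scope.
Local Open Scope ring_scope.

(* By the law of [X(t)] given [Y(t) = j], everything is a statement about the
   densities [1 + xi_j eta] with respect to [varpi].  Write [n = |eta(-oo)|] and
   [m = eta(+oo)].
   The flux [J = eps exp(- F / eps) eta'] satisfies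
   [J' = - lambda eta exp(- F / eps)].  On the side of 0 on which [eta] does not
   change sign, comparing the increments of [J] and [eta] gives
   [lambda <= C eps exp(- c / eps)].  As [J(-oo) = 0] and [- n <= eta], the flux
   is small near [x0], so that [eta + n <= o(n)] there, and up to the saddle
   [eta - eta x0 <= n o(1) exp((F - F x0) / eps)], a bound whose integral against
   the Gibbs weight over [[x0, 0]] is negligible.  Hence the integral of
   [(eta + n) / n] over the left half-line tends to 0 and, as [varpi]
   concentrates there, [P(X <= 0 | Y = 1) = 1 - xi_1 n + o(1)], which is the
   equivalence of (1) and (a).
   The reflected bound gives [m <= 2 eta x1], so that for [xi_1 > 0] the density
   [1 + xi_1 eta] is at most twice its value at [x1] and Laplace's method
   concentrates the conditional law at [x1]; this is (b).  Finally [eta] has mean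
   zero, so [n <= 2 m], the density of the other state is at most 3 on the right
   half-line, and that half-line is negligible. *)

(** * Mean value inequalities *)

Section mean_value.
Context {R : realType}.
Implicit Types f : R -> R.

Lemma is_derive_continuous f (df : R -> R) : (forall x : R, is_derive x 1 f (df x)) ->
  continuous f.
Proof.
move=> fdf x; apply: differentiable_continuous; apply/derivable1_diffP.
by have [] := fdf x.
Qed.

Lemma mean_value f (df : R -> R) a b : (forall x : R, is_derive x 1 f (df x)) -> a <= b ->
  exists2 c, a <= c <= b & f b - f a = df c * (b - a).
Proof.
move=> fdf ab; have [|c cab ->] := @MVT_segment R f df a b ab.
- by apply: continuous_subspaceT; exact: is_derive_continuous fdf.
- by exists c; rewrite ?in_itv in cab *.
Qed.

Lemma mean_value_in f (df : R -> R) a b :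
  (forall x : R, a <= x <= b -> is_derive x 1 f (df x)) -> a <= b ->
  exists2 c, a <= c <= b & f b - f a = df c * (b - a).
Proof.
move=> fdf ab; have [||c cab ->] := @MVT_segment R f df a b ab.
- move=> x; rewrite in_itv/= => /andP[ax xb]; apply: fdf.
  by rewrite !ltW.
- apply: derivable_within_continuous => x; rewrite in_itv/= => axb.
  by have [] := fdf _ axb.
- by exists c; rewrite ?in_itv in cab *.
Qed.

Lemma is_derive_reflect f (df x : R) :
  is_derive (- x) 1 f df -> is_derive x 1 (fun y => f (- y)) (- df).
Proof.
move=> fdf.
have := @is_derive1_comp R f -%R x df (- 1) fdf (is_deriveNid x 1).
by rewrite mulrN1.
Qed.

Lemma is_derive_expRN_scale f (eps x df : R) : is_derive x 1 f df ->
  is_derive x 1 (fun y => expR (- f y / eps))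
    (- (df / eps * expR (- f x / eps))).
Proof.
move=> fdf; pose g y := - f y / eps.
have gE : g = (fun y => - eps^-1 * f y).
  by apply: funext => y; rewrite /g mulrC mulrN mulNr.
have dg : is_derive x 1 g (- eps^-1 * df).
  by rewrite gE; exact: (is_deriveZ (- eps^-1) fdf).
have := is_derive1_comp (is_derive_expR (g x)) dg.
by move/is_derive_eq; apply; rewrite /g; ring.
Qed.

End mean_value.

(** * The flux of the eigenfunction *)

(* [J] stands for [eps * expR (- F / eps) * eta'], so that the second-order
   equation [eps eta'' - F' eta' = - lambda eta] becomes a first-order system
   that does not involve the derivative of [F]; [- n] and [m] are the limits of
   [eta] at [-oo] and [+oo]. *)
Record eigen_system (R : realType) (F : R -> R) (eps lambda n m : R)
    (eta J : R -> R) : Prop := EigenSystem {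
  es_eps : 0 < eps ;
  es_n : 0 < n ;
  es_m : 0 < m ;
  es_lambda : 0 < lambda ;
  es_eta : forall x : R, is_derive x 1 eta (J x * expR (F x / eps) / eps) ;
  es_J : forall x : R, is_derive x 1 J (- (lambda * eta x * expR (- F x / eps))) ;
  es_incr : {homo eta : x y / x < y} ;
  es_lb : forall x, - n <= eta x ;
  es_ub : forall x, eta x <= m ;
  es_inf : forall e M, 0 < e -> exists2 x, x < M & eta x < - n + e ;
  es_sup : forall e M, 0 < e -> exists2 x, M < x & m - e < eta x }.

(** Phrased for one half-line, with the derivative [F1] as separate data, so that it applies to [F]
    with [z = x0] and to [fun x => F (- x)] with [z = - x1]. The exponent [s > 1] makes |x|^(-s)
    integrable at infinity. *)
Record left_well (R : realType) (F F1 : R -> R) (s M z : R) : Prop := {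
  lw_s : 1 < s ;
  lw_M : 1 <= M ;
  lw_z : - M <= z <= 0 ;
  lw_derive : forall x : R, is_derive x 1 F (F1 x) ;
  lw_tail : forall x, x <= - M -> F1 x <= - (- x) `^ s ;
  lw_decr : forall x y, x <= y -> y <= z -> F y <= F x ;
  lw_incr : forall x y, z <= x -> x <= y -> y <= 0 -> F x <= F y }.

Section eigen_system_theory.
Context {R : realType}.
Implicit Types F eta J : R -> R.

(** Reversing both the line and the sign of [eta] keeps [eta] increasing and the flux nonnegative,
    and exchanges [n] and [m]; each estimate on the left half-line thus gives one on the right. *)
Lemma eigen_system_reflect F eps lambda n m eta J :
  eigen_system F eps lambda n m eta J ->
  eigen_system (fun x => F (- x)) eps lambda m n
    (fun x => - eta (- x)) (fun x => J (- x)).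
Proof.
move=> [e0 n0 m0 l0 de dJ inc lb ub ei es]; split => //.
- move=> x; have := is_deriveN (is_derive_reflect (de (- x))).
  by rewrite opprK.
- by move=> x; apply: (is_derive_eq (is_derive_reflect (dJ (- x)))); ring.
- by move=> x y xy; rewrite ltrN2 inc// ltrN2.
- by move=> x; rewrite lerN2.
- by move=> x; rewrite lerNl.
- move=> e M e_gt0; have [x Mx xe] := es e (- M) e_gt0.
  by exists (- x); [rewrite ltrNl|rewrite opprK ltrNl opprD opprK].
- move=> e M e_gt0; have [x Mx xe] := ei e (- M) e_gt0.
  by exists (- x); [rewrite ltrNr|rewrite opprK ltrNr opprB addrC].
Qed.

Section fixed.
Variables (F eta J : R -> R) (eps lambda n m : R).
Hypothesis ES : eigen_system F eps lambda n m eta J.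
Let eps0 := es_eps ES.
Let lambda0 := es_lambda ES.

Lemma eigen_system_nondecreasing x y : x <= y -> eta x <= eta y.
Proof. by rewrite le_eqVlt => /predU1P[->//|/(es_incr ES)/ltW]. Qed.

Lemma eigen_system_lt_sup x : eta x < m.
Proof.
have /(es_incr ES) h : x < x + 1 by rewrite ltrDl.
exact: lt_le_trans h (es_ub ES _).
Qed.

Lemma flux_ge0 x : 0 <= J x.
Proof.
have : 0 <= eta^`()%classic x.
  apply: (@incr_derive1_ge0 _ _ setT) => //.
  - by move=> y _; have [] := es_eta ES y.
  - by move=> y z _ _; exact: es_incr ES y z.
  - exact: filterT.
rewrite derive1E (@derive_val _ _ _ _ _ _ _ (es_eta ES x)).
by rewrite pmulr_lge0 ?invr_gt0// pmulr_lge0// expR_gt0.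
Qed.

(** Where [eta >= 0] the flux decreases. Its variation over [p, b] bounds [J p] below by a multiple
    of [lambda * eta p]; the variation of [eta] over [0, q] bounds [eta p] below by a multiple of
    [J p]. Chaining the two, the positive factor [eta p] cancels and the drop of [F] from [q] to [p]
    remains in the exponent. *)
Lemma eigenvalue_bound q p b : 0 < q -> q < p -> p < b ->
  (forall x y, 0 <= x -> x <= y -> y <= b -> F y <= F x) -> 0 <= eta 0 ->
  lambda / eps * (q * (b - p)) <= expR (- ((F q - F p) / eps)).
Proof.
move=> q0 qp pb Fdecr eta0.
have etap0 : 0 < eta p.
  by apply: le_lt_trans eta0 _; apply: (es_incr ES); exact: lt_trans qp.
have Jp : lambda * eta p * expR (- F p / eps) * (b - p) <= J p.
  have [c /andP[pc cb] Jbp] := mean_value (es_J ES) (ltW pb).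
  have -> : J p = J b + lambda * eta c * expR (- F c / eps) * (b - p).
    by rewrite -[LHS](subKr (J b)) Jbp mulNr opprK.
  apply: (le_trans _ (ler_wpDl (flux_ge0 b) (lexx _))).
  rewrite ler_pM2r ?subr_gt0// ler_pM ?expR_ge0 ?mulr_ge0 ?(ltW etap0) ?(ltW lambda0)//.
    by rewrite ler_wpM2l ?(ltW lambda0)// eigen_system_nondecreasing.
  rewrite ler_expR ler_pM2r ?invr_gt0// lerN2 Fdecr//.
  by rewrite ltW// (lt_trans q0).
have [c /andP[c0 cq] etaq] := mean_value (es_eta ES) (ltW q0).
have JpJc : J p <= J c.
  have cp : c <= p by apply: le_trans cq (ltW qp).
  have [e /andP[ce ep] Jpc] := mean_value (es_J ES) cp.
  rewrite -subr_le0 Jpc mulNr oppr_le0 !mulr_ge0 ?expR_ge0 ?(ltW lambda0)//.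
    by rewrite (le_trans eta0)// eigen_system_nondecreasing// (le_trans c0).
  by rewrite subr_ge0.
have : J p * expR (F q / eps) / eps * q <= eta p.
  apply: (@le_trans _ _ (eta q)); last exact: eigen_system_nondecreasing (ltW qp).
  apply: (@le_trans _ _ (eta q - eta 0)); last by rewrite gerBl.
  rewrite etaq subr0 ler_pM2r// ler_pM2r ?invr_gt0//.
  rewrite ler_pM ?flux_ge0 ?expR_ge0//.
  rewrite ler_expR ler_pM2r ?invr_gt0// Fdecr//.
  by rewrite ltW// (lt_trans qp).
move=> etap.
have {}etap : lambda * eta p * expR (- F p / eps) * (b - p) *
    expR (F q / eps) / eps * q <= eta p.
  apply: le_trans etap; rewrite ler_pM2r// ler_pM2r ?invr_gt0//.
  by rewrite ler_pM2r ?expR_gt0.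
rewrite -(ler_pM2l etap0) expRN -(ler_pM2r (expR_gt0 ((F q - F p) / eps))).
rewrite mulfVK ?gt_eqF ?expR_gt0//; apply: le_trans etap.
by rewrite mulrBl expRD -mulNr le_eqVlt; apply/orP; left; apply/eqP; ring.
Qed.

End fixed.

(** * Flux and eigenfunction on the half-line of a well *)

Section left_tail.
Variables (F F1 eta J : R -> R) (eps lambda n m s M z : R).
Hypothesis ES : eigen_system F eps lambda n m eta J.
Hypothesis LW : left_well F F1 s M z.
Let eps0 := es_eps ES.
Let n0 := es_n ES.
Let lambda0 := es_lambda ES.

(* A flux bounded away from 0 near [-oo] would make [eta] unbounded. *)
Lemma flux_inf e y : 0 < e -> exists2 x, x < y & J x < e.
Proof.
move=> e0; apply: contrapT => /forall2NP h.
have {}h x : x < y -> e <= J x by case: (h x) => // /negP; rewrite -leNgt.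
pose y' := Num.min y z - 1.
have y'y : y' < y.
  by rewrite /y' ltrBlDr gt_min ltrDl ltr01.
have y'z : y' <= z.
  by rewrite /y' lerBlDr ge_min lerDl ler01 orbT.
(* [c] bounds eta' from below on the left of [y'], where [F >= F z]. Over a length [(m + n) / c] the
   eigenfunction would climb by [m + n], more than its range allows. *)
pose c := e * expR (F z / eps) / eps.
have c0 : 0 < c by rewrite !mulr_gt0 ?expR_gt0 ?invr_gt0.
have T0 : 0 < (m + n) / c by rewrite divr_gt0// addr_gt0// (es_m ES).
have xy' : y' - (m + n) / c <= y' by rewrite gerBl ltW.
have [u /andP[_ uy'] eq] := mean_value (es_eta ES) xy'.
have : eta y' - eta (y' - (m + n) / c) < m + n.
  by rewrite ltrBlDr (lt_le_trans (eigen_system_lt_sup ES y'))//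
    -addrA lerDl -lerBlDl sub0r (es_lb ES).
rewrite eq opprB addrCA subrr addr0; apply/negP; rewrite -leNgt.
rewrite -{1}(mulfVK (lt0r_neq0 c0) (m + n)) mulrC ler_pM2r//.
rewrite /c ler_pM2r ?invr_gt0// ler_pM ?(ltW e0) ?expR_ge0//.
  by apply: h; exact: le_lt_trans y'y.
rewrite ler_expR ler_pM2r ?invr_gt0//.
by apply: (lw_decr LW) => //; exact: le_trans y'z.
Qed.

Let powR_tail_derive (a y : R) : y < 0 ->
  is_derive y 1 (fun x => (- x) `^ a) (- (a * (- y) `^ (a - 1))).
Proof.
rewrite -oppr_gt0 => y0.
have h := @is_derive1_powR R a (- y) y0; exact: (is_derive_reflect h).
Qed.

Let M0 : 0 < M. Proof. exact: lt_le_trans ltr01 (lw_M LW). Qed.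

Let powM_ge1 a : 0 <= a -> 1 <= M `^ a.
Proof.
by move=> a0; rewrite -[leLHS](powRr0 M) ler_powR// (lw_M LW).
Qed.

(* [lambda n eps expR (- F / eps) |x|^- s] is a supersolution of the equation
   for the flux. *)
Lemma flux_tail y : y <= - M ->
  J y <= lambda * n * eps * (expR (- F y / eps) * (- y) `^ (- s)).
Proof.
move=> yM.
pose D x := lambda * n * eps * (expR (- F x / eps) * (- x) `^ (- s)) - J x.
pose dD x := lambda * n * eps *
  (expR (- F x / eps) * (s * (- x) `^ (- s - 1)) +
   (- x) `^ (- s) * (- (F1 x / eps * expR (- F x / eps))))
  + lambda * eta x * expR (- F x / eps).
have dDP x : x <= - M -> is_derive x 1 D (dD x).
  move=> xM; have x0 : x < 0 by rewrite (le_lt_trans xM)// oppr_lt0.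
  have dw := is_derive_expRN_scale eps (lw_derive LW x).
  have dp := powR_tail_derive (- s) x0.
  have dJ := es_J ES x.
  rewrite (_ : D = (lambda * n * eps) \*:
    ((fun x => expR (- F x / eps)) * (fun x => (- x) `^ (- s))) - J)//.
  apply: is_derive_eq; rewrite /dD /GRing.scale/=; ring.
(* By [lw_tail], |x|^(-s) times -F'(x) is at least 1, so the bracket multiplying [n] is at least 1,
   which compensates [eta >= - n]. *)
have dD0 x : x <= - M -> 0 <= dD x.
  move=> xM; have x0 : 0 < - x by rewrite lerNr in xM; exact: lt_le_trans xM.
  have -> : dD x = lambda * expR (- F x / eps) *
      (n * (eps * s * (- x) `^ (- s - 1) + (- x) `^ (- s) * (- F1 x)) + eta x).
    rewrite /dD; field; exact: lt0r_neq0.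
  apply: mulr_ge0; first by rewrite mulr_ge0 ?expR_ge0// ltW.
  rewrite -(opprK (eta x)) subr_ge0 lerNl; apply: le_trans (es_lb ES x).
  rewrite lerN2 ler_peMr ?(ltW n0)//.
  have s0 : 0 <= s by rewrite ltW// (lt_trans ltr01)// (lw_s LW).
  apply: ler_wpDl; first by rewrite !mulr_ge0 ?powR_ge0// ltW.
  rewrite powRN ler_pdivlMl ?powR_gt0// mulr1.
  by rewrite lerNr; exact: (lw_tail LW).
suff : 0 <= D y by rewrite subr_ge0.
(* The comparison starts at a far point [x] given by [flux_inf], where [J x < e] forces
   [D x >= - e]; [D] does not decrease from there to [y]. *)
apply/ler_addgt0Pl => e e0; rewrite -lerBlDl sub0r.
have [x xy Jx] := flux_inf y e0.
have [w /andP[xw wy] Dyx] : exists2 w, x <= w <= y & D y - D x = dD w * (y - x).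
  apply: mean_value_in; last exact: ltW.
  by move=> w /andP[_ wy]; apply: dDP; exact: le_trans yM.
apply: (@le_trans _ _ (D x)); last first.
  rewrite -subr_ge0 Dyx mulr_ge0// ?subr_ge0 ?(ltW xy)//.
  by apply: dD0; exact: le_trans yM.
apply: (@le_trans _ _ (- J x)); first by rewrite lerN2 ltW.
by rewrite lerDr !mulr_ge0 ?expR_ge0 ?powR_ge0 ?ltW.
Qed.

(** In eta' the weight exp(F / eps) cancels that of [flux_tail], which leaves at most [lambda * n]
    times |x|^(-s). The antiderivative, vanishing at infinity as [s > 1], is the term subtracted in
    [T]; [M >= 1] bounds it at [- M]. *)
Lemma eigen_system_tail : eta (- M) + n <= lambda * n / (s - 1).
Proof.
have s1 : 0 < s - 1 by rewrite subr_gt0 (lw_s LW).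
pose T x := eta x - lambda * n / (s - 1) * (- x) `^ (1 - s).
pose dT x := J x * expR (F x / eps) / eps - lambda * n * (- x) `^ (- s).
have dTP x : x <= - M -> is_derive x 1 T (dT x).
  move=> xM; have x0 : x < 0 by rewrite (le_lt_trans xM)// oppr_lt0.
  have dp := powR_tail_derive (1 - s) x0.
  have de := es_eta ES x.
  rewrite (_ : T = eta - (lambda * n / (s - 1)) \*: (fun x => (- x) `^ (1 - s)))//.
  apply: is_derive_eq; rewrite /dT /GRing.scale/=.
  rewrite (_ : 1 - s - 1 = - s); last by ring.
  by field; rewrite !lt0r_neq0.
have dT0 x : x <= - M -> dT x <= 0.
  move=> xM; rewrite subr_le0 ler_pdivrMr// mulrC.
  have -> : expR (F x / eps) = (expR (- F x / eps))^-1.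
    by rewrite -expRN mulNr opprK.
  rewrite ler_pdivrMl ?expR_gt0//; apply: le_trans (flux_tail xM) _.
  by rewrite le_eqVlt; apply/orP; left; apply/eqP; ring.
apply/ler_addgt0Pl => e e0.
have [x xM etax] := es_inf ES (- M) e0.
have [w /andP[xw wM] Teq] : exists2 w, x <= w <= - M &
    T (- M) - T x = dT w * (- M - x).
  apply: mean_value_in; last exact: ltW.
  by move=> w /andP[_ wy]; exact: dTP.
have : T (- M) <= T x.
  by rewrite -subr_le0 Teq mulr_le0_ge0// ?subr_ge0 ?(ltW xM)// dT0.
rewrite /T opprK => h.
have c0 : 0 <= lambda * n / (s - 1).
  by rewrite divr_ge0 ?mulr_ge0// ltW.
have h1 : lambda * n / (s - 1) * M `^ (1 - s) <= lambda * n / (s - 1).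
  rewrite ler_piMr// -opprB powRN invf_le1 ?powR_gt0//.
  by rewrite powM_ge1// ltW.
have h2 : 0 <= lambda * n / (s - 1) * (- x) `^ (1 - s).
  by rewrite mulr_ge0// powR_ge0.
lra.
Qed.

Let n_ge0 := ltW n0.
Let ln0 : 0 <= lambda * n. Proof. by rewrite mulr_ge0// ltW. Qed.

Lemma flux_increment x y : x <= y -> exists2 c, x <= c <= y &
  J y <= J x + lambda * n * expR (- F c / eps) * (y - x).
Proof.
move=> xy; have [c cxy Jyx] := mean_value (es_J ES) xy; exists c => //.
rewrite -lerBlDl Jyx ler_wpM2r ?subr_ge0// -mulNr ler_wpM2r ?expR_ge0//.
by rewrite -mulrN ler_wpM2l// ?(ltW lambda0)// lerNl (es_lb ES).
Qed.

Hypothesis eps1 : eps <= 1.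

(** The flux at [- M] comes from the tail, the rest from [flux_increment]. As [F] decreases up to
    [z], both weights are at most the one at [y]; [eps <= 1] absorbs the factor [eps] of the tail
    bound. *)
Lemma flux_left y : - M <= y -> y <= z ->
  J y <= lambda * n * (M + 1) * expR (- F y / eps).
Proof.
move=> My yz; have [c /andP[Mc cy] Jy] := flux_increment My.
have FcFy : expR (- F c / eps) <= expR (- F y / eps).
  by rewrite ler_expR ler_pM2r ?invr_gt0// lerN2 (lw_decr LW).
have FMFy : expR (- F (- M) / eps) <= expR (- F y / eps).
  by rewrite ler_expR ler_pM2r ?invr_gt0// lerN2 (lw_decr LW).
have JM : J (- M) <= lambda * n * expR (- F y / eps).
  apply: le_trans (flux_tail (lexx _)) _; rewrite opprK -mulrA ler_wpM2l//.
  rewrite -[leRHS]mul1r ler_pM ?(ltW eps0) ?mulr_ge0 ?expR_ge0 ?powR_ge0//.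
  rewrite -[leRHS]mulr1 ler_pM ?expR_ge0 ?powR_ge0//.
  rewrite powRN invf_le1 ?powR_gt0// powM_ge1//.
  by rewrite ltW// (lt_trans ltr01)// (lw_s LW).
apply: (le_trans Jy).
have -> : lambda * n * (M + 1) * expR (- F y / eps) =
    lambda * n * expR (- F y / eps) + lambda * n * M * expR (- F y / eps) by ring.
rewrite lerD//.
rewrite mulrAC; apply: ler_pM => //; rewrite ?mulr_ge0 ?expR_ge0 ?(ltW lambda0)//.
- by rewrite subr_ge0.
- by rewrite ler_wpM2l//; have := lw_z LW; lra.
Qed.

(** The climb over [- M, z] adds to that of the tail. The weight in [flux_left] cancels the factor
    exp(F / eps) of eta', so no exponentially large constant appears. *)
Lemma eigen_system_well :
  eta z + n <= n * (lambda / eps) * ((s - 1)^-1 + M * (M + 1)).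
Proof.
have [Mz z0] := andP (lw_z LW).
have [c /andP[Mc cz] eq] := mean_value (es_eta ES) Mz.
have -> : eta z + n = (eta z - eta (- M)) + (eta (- M) + n) by ring.
rewrite eq [leRHS]mulrDr [leRHS]addrC lerD//; last first.
  apply: (le_trans eigen_system_tail); rewrite ler_wpM2r//.
    by rewrite invr_ge0 subr_ge0 ltW// (lw_s LW).
  by rewrite mulrC ler_wpM2l// ler_peMr ?(ltW lambda0)// invf_ge1.
have -> : n * (lambda / eps) * (M * (M + 1)) =
  lambda * n * (M + 1) * expR (- F c / eps) * expR (F c / eps) / eps * M.
  rewrite -(mulrA _ (expR (- F c / eps))) -expRD mulNr addNr expR0; ring.
apply: ler_pM => //.
- by rewrite !mulr_ge0 ?expR_ge0 ?invr_ge0 ?(flux_ge0 ES) ?(ltW eps0).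
- by rewrite subr_ge0.
- rewrite ler_pM2r ?invr_gt0// ler_pM2r ?expR_gt0//.
  by apply: flux_left.
- by lra.
Qed.

(** Past the bottom [z] the weight exp(- F / eps) is at most its value at [z], so the flux stays of
    that order, while exp(F / eps) is largest at the right end [x]. *)
Lemma eigen_system_saddle x : z <= x -> x <= 0 ->
  eta x - eta z <=
  n * (lambda / eps) * (M * (2 * M + 1)) * expR ((F x - F z) / eps).
Proof.
move=> zx x0.
have [Mz z0] := andP (lw_z LW).
have xz : x - z <= M by lra.
have [c /andP[zc cx] eq] := mean_value (es_eta ES) zx.
have Jc : J c <= lambda * n * (2 * M + 1) * expR (- F z / eps).
  have [d /andP[zd dc] Jc] := flux_increment zc.
  apply: (le_trans Jc).
  have -> : lambda * n * (2 * M + 1) * expR (- F z / eps) =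
      lambda * n * (M + 1) * expR (- F z / eps) +
      lambda * n * M * expR (- F z / eps) by ring.
  rewrite lerD ?flux_left//.
  rewrite mulrAC; apply: ler_pM => //; rewrite ?mulr_ge0 ?expR_ge0 ?(ltW lambda0)//.
  - by rewrite subr_ge0.
  - by rewrite ler_wpM2l//; lra.
  - rewrite ler_expR ler_pM2r ?invr_gt0// lerN2 (lw_incr LW)//.
    exact: le_trans dc (le_trans cx x0).
rewrite eq.
have FcFx : expR (F c / eps) <= expR (F x / eps).
  by rewrite ler_expR ler_pM2r ?invr_gt0// (lw_incr LW).
have -> : n * (lambda / eps) * (M * (2 * M + 1)) * expR ((F x - F z) / eps) =
  lambda * n * (2 * M + 1) * expR (- F z / eps) * expR (F x / eps) / eps * M.
  by rewrite mulrBl expRD mulNr; ring.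
apply: ler_pM => //; rewrite ?subr_ge0//.
  by rewrite !mulr_ge0 ?expR_ge0 ?invr_ge0 ?(flux_ge0 ES)// ltW.
rewrite ler_pM2r ?invr_gt0//.
by apply: ler_pM => //; rewrite ?expR_ge0 ?(flux_ge0 ES).
Qed.

End left_tail.
End eigen_system_theory.

(** * Growth and shape of the potential *)

Section double_well_theory.
Context {R : realType}.

Lemma powR_large (d K : R) : 0 < d ->
  exists2 T, 1 <= T & forall t, T <= t -> K <= t `^ d.
Proof.
move=> d0; exists (Num.max 1 (`|K| `^ d^-1)); first by rewrite le_max lexx.
move=> t; rewrite ge_max => /andP[t1 Kt]; apply: le_trans (ler_norm K) _.
have -> : `|K| = (`|K| `^ d^-1) `^ d.
  by rewrite -powRrM mulVf ?gt_eqF// powRr1.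
apply: ge0_ler_powR => //; rewrite ?nnegrE ?powR_ge0 ?(ltW d0)//.
exact: le_trans t1.
Qed.

Lemma derive_le0_le (f : R -> R) (df : R -> R) x y :
  (forall x : R, is_derive x 1 f (df x)) -> x <= y ->
  (forall c, x < c < y -> df c <= 0) -> f y <= f x.
Proof.
move=> fdf; rewrite le_eqVlt => /predU1P[->//|xy df0].
have [|c] := @MVT R f df x y xy.
  by apply: continuous_subspaceT; exact: is_derive_continuous fdf.
rewrite in_itv/= => cxy fyx.
by rewrite -subr_le0 fyx mulr_le0_ge0 ?subr_ge0 ?(ltW xy)// df0.
Qed.

Lemma derive_ge0_le (f : R -> R) (df : R -> R) x y :
  (forall x : R, is_derive x 1 f (df x)) -> x <= y ->
  (forall c, x < c < y -> 0 <= df c) -> f x <= f y.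
Proof.
move=> fdf; rewrite le_eqVlt => /predU1P[->//|xy df0].
have [|c] := @MVT R f df x y xy.
  by apply: continuous_subspaceT; exact: is_derive_continuous fdf.
rewrite in_itv/= => cxy fyx.
by rewrite -subr_ge0 fyx mulr_ge0 ?subr_ge0 ?(ltW xy)// df0.
Qed.

Lemma decreasing_itvoo_derive_le0 (f : R -> R) (df : R -> R) a b c :
  (forall x : R, is_derive x 1 f (df x)) ->
  {in `]a, b[ &, {homo f : x y / x < y >-> y < x}} -> a < c < b -> df c <= 0.
Proof.
move=> fdf hf cab; have [_ <-] := fdf c; rewrite -derive1E.
apply: (@decr_derive1_le0_itv _ _ false true a b).
- by move=> x _; have [] := fdf x.
- by move=> x y xab yab xy; exact: hf.
- by rewrite in_itv.
Qed.

Lemma increasing_itvoo_derive_ge0 (f : R -> R) (df : R -> R) a b c :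
  (forall x : R, is_derive x 1 f (df x)) ->
  {in `]a, b[ &, {homo f : x y / x < y}} -> a < c < b -> 0 <= df c.
Proof.
move=> fdf hf cab; have [_ <-] := fdf c; rewrite -derive1E.
apply: (@incr_derive1_ge0_itv _ _ false true a b).
- by move=> x _; have [] := fdf x.
- by move=> x y xab yab xy; exact: hf.
- by rewrite in_itv.
Qed.

Section well.
Variables (F : continuousType R R) (x0 x1 : R).
Hypothesis hF : double_well F x0 x1.
Local Notation F1 := (F^`()%classic).
Let x0_lt0 := dw_x0_lt0 hF.
Let x1_gt0 := dw_x1_gt0 hF.

Lemma double_well_is_derive (x : R) : is_derive x 1 (F : R -> R) (F1 x).
Proof.
have [h _] := dw_C3 hF; have := h 0%N x erefl.
by rewrite /= => dF; apply: DeriveDef => //; rewrite derive1E.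
Qed.

Let dF := double_well_is_derive.

(** The monotonicity assumptions concern open intervals; passing through the sign of F' yields weak
    monotonicity up to the endpoints in the lemmas that follow. *)
Lemma double_well_derive_sign c :
  [/\ c < x0 -> F1 c <= 0, x0 < c < 0 -> 0 <= F1 c,
      0 < c < x1 -> F1 c <= 0 & x1 < c -> 0 <= F1 c].
Proof.
split.
- move=> cx0; apply: (decreasing_itvoo_derive_le0 (a := c - 1) (b := x0) dF).
    move=> x y; rewrite !in_itv/= => /andP[_ xx0] /andP[_ yx0].
    by apply: (dw_decr_left hF); rewrite in_itv.
  by rewrite cx0 gtrBl ltr01.
- exact: increasing_itvoo_derive_ge0 dF (dw_incr_left hF).
- exact: decreasing_itvoo_derive_le0 dF (dw_decr_right hF).
- move=> x1c; apply: (increasing_itvoo_derive_ge0 (a := x1) (b := c + 1) dF).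
    move=> x y; rewrite !in_itv/= => /andP[xx0 _] /andP[yx0 _].
    by apply: (dw_incr_right hF); rewrite in_itv/= andbT.
  by rewrite x1c ltrDl ltr01.
Qed.

Lemma double_well_decr_left x y : x <= y -> y <= x0 -> F y <= F x.
Proof.
move=> xy yx0; apply: (derive_le0_le dF xy) => c /andP[_ cy].
by have [+ _ _ _] := double_well_derive_sign c; apply; exact: lt_le_trans yx0.
Qed.

Lemma double_well_incr_left x y : x0 <= x -> x <= y -> y <= 0 -> F x <= F y.
Proof.
move=> x0x xy y0; apply: (derive_ge0_le dF xy) => c /andP[xc cy].
have [_ + _ _] := double_well_derive_sign c; apply.
by rewrite (le_lt_trans x0x)// (lt_le_trans cy).
Qed.

Lemma double_well_decr_right x y : 0 <= x -> x <= y -> y <= x1 -> F y <= F x.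
Proof.
move=> x_ge0 xy yx1; apply: (derive_le0_le dF xy) => c /andP[xc cy].
have [_ _ + _] := double_well_derive_sign c; apply.
by rewrite (le_lt_trans x_ge0)// (lt_le_trans cy).
Qed.

Lemma double_well_incr_right x y : x1 <= x -> x <= y -> F x <= F y.
Proof.
move=> x1x xy; apply: (derive_ge0_le dF xy) => c /andP[xc _].
by have [_ _ _ +] := double_well_derive_sign c; apply; exact: le_lt_trans xc.
Qed.

Lemma double_well_min_right x : 0 <= x -> F x1 <= F x.
Proof.
move=> x_ge0; have [xx1|x1x] := leP x x1; first exact: double_well_decr_right.
by apply: double_well_incr_right => //; exact: ltW.
Qed.

Lemma double_well_min x : F x0 <= F x.
Proof.
have [x_ge0|x_lt0] := leP 0 x.
  exact: le_trans (ltW (dw_deeper hF)) (double_well_min_right x_ge0).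
have [xx0|x0x] := leP x x0; first exact: double_well_decr_left.
by apply: double_well_incr_left => //; exact: ltW.
Qed.

(* Comparing the two growth bounds on [F'] gives [a1 <= a2], so that the
   condition [a2 < 2 a1 - 2] forces [a1 > 2]. *)
Lemma double_well_growth : exists s M, [/\ 1 < s, 1 <= M, - M < x0, x1 < M &
  forall x, M <= `|x| -> `|x| `^ s <= `|F1 x| /\ 2 * `|x| <= `|F1 x|].
Proof.
have [a1 [a2 [c1 [c2 [c3 [c4]]]]]] := dw_growth hF.
move=> [[a1_gt0 a2_gt0 a12] [[c1_gt0 c2_gt0 c3_gt0 c4_gt0] [growth _]]].
have a1a2 : a1 <= a2.
  rewrite leNgt; apply/negP => a21.
  have d0 : 0 < a1 - a2 by rewrite subr_gt0.
  have [T T1 Tlarge] := powR_large ((c3 + c2 + c4 + 1) / c1) d0.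
  have T0 : 0 < T := lt_le_trans ltr01 T1.
  have /andP[l u] := growth T; have {l u} := le_trans l u.
  rewrite gtr0_norm// (_ : T `^ a1 = T `^ a2 * T `^ (a1 - a2)); last first.
    by rewrite -powRD ?[a2 + _]addrC ?subrK// (gt_eqF T0) implybT.
  have := Tlarge T (lexx _); rewrite ler_pdivrMr// mulrC.
  have : 1 <= T `^ a2 by rewrite -[leLHS](powRr0 T) ler_powR// ltW.
  move: (T `^ a2) (T `^ (a1 - a2)) => u v u1 v1 uv.
  have : u * (c3 + c2 + c4 + 1) <= u * (c1 * v) by rewrite ler_wpM2l ?(le_trans ler01).
  nra.
have a1_gt2 : 2 < a1 by lra.
(* The midpoint of 1 and [a1 / 2]: it leaves a spare power [a1 - 2 * s > 0] to beat the constants in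
   the lower bound for the square of F'. *)
pose s := (a1 / 2 + 1) / 2.
have s1 : 1 < s by rewrite /s; lra.
have d0 : 0 < a1 - 2 * s by rewrite /s; lra.
have [T T1 Tlarge] := powR_large ((c2 + 1) / c1) d0.
have s10 : 0 < s - 1 by rewrite subr_gt0.
have [T' T'1 T'large] := powR_large 2 s10.
(* [T] and [T'] serve the two growth bounds; the last two terms push both minima inside (- M, M). *)
exists s, (Num.max (Num.max T T') (Num.max (1 - x0) (1 + x1))); split => //.
- by rewrite !le_max T1.
- by rewrite ltrNl !lt_max ltrDr ltr01 !orbT.
- by rewrite !lt_max ltrDr ltr01 !orbT.
move=> x; rewrite !ge_max => /andP[/andP[Tx T'x] _].
have x_ge1 : 1 <= `|x| := le_trans T1 Tx.
have x_gt0 : 0 < `|x| := lt_le_trans ltr01 x_ge1.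
have h1 : `|x| `^ s <= `|F1 x|.
  rewrite -ler_sqr ?nnegrE ?powR_ge0//.
  have /andP[h _] := growth x; apply: (le_trans _ h) => {h}.
  rewrite (_ : `|x| `^ a1 = (`|x| `^ s) ^+ 2 * `|x| `^ (a1 - 2 * s)); last first.
    rewrite -powR_mulrn ?powR_ge0// -powRrM -powRD ?(gt_eqF x_gt0) ?implybT//.
    by congr (_ `^ _); ring.
  have := Tlarge _ Tx; rewrite ler_pdivrMr// mulrC.
  have : 1 <= `|x| `^ s.
    by rewrite -[leLHS](powRr0 `|x|) ler_powR// ltW// (lt_trans ltr01).
  move: (`|x| `^ s) (`|x| `^ (a1 - 2 * s)) => u v u1 v1.
  have : 1 <= u ^+ 2 by rewrite expr_ge1// (le_trans ler01).
  have : u ^+ 2 * (c2 + 1) <= u ^+ 2 * (c1 * v) by rewrite ler_wpM2l ?sqr_ge0.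
  nra.
split=> //; apply: le_trans h1.
rewrite (_ : `|x| `^ s = `|x| `^ (s - 1) * `|x|); last first.
  by rewrite -{3}(powRr1 (ltW x_gt0)) -powRD ?subrK// (gt_eqF x_gt0) implybT.
by rewrite ler_pM2r// T'large.
Qed.

Lemma left_well_double_well s M :
  1 < s -> 1 <= M -> - M < x0 ->
  (forall x, M <= `|x| -> `|x| `^ s <= `|F1 x|) ->
  left_well F F1 s M x0.
Proof.
move=> s1 M1 Mx0 growth; split => //.
- by rewrite !ltW.
- move=> x xM.
  have x_lt0 : x < 0.
    by rewrite (le_lt_trans xM)// oppr_lt0 (lt_le_trans ltr01).
  have := growth x; rewrite ltr0_norm// lerNr => /(_ xM).
  have -> : `|F1 x| = - F1 x; last by rewrite lerNr.
  rewrite ler0_norm//; have [+ _ _ _] := double_well_derive_sign x.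
  by apply; exact: le_lt_trans xM Mx0.
- exact: double_well_decr_left.
- exact: double_well_incr_left.
Qed.

Lemma left_well_double_well_reflect s M :
  1 < s -> 1 <= M -> x1 < M ->
  (forall x, M <= `|x| -> `|x| `^ s <= `|F1 x|) ->
  left_well (fun x => F (- x)) (fun x => - F1 (- x)) s M (- x1).
Proof.
move=> s1 M1 x1M growth; split => //.
- by rewrite lerN2 oppr_le0 !ltW.
- by move=> x; exact: is_derive_reflect.
- move=> x xM; have Mx : M <= - x by rewrite lerNr.
  have x_gt0 : 0 < - x by rewrite (lt_le_trans _ Mx)// (lt_le_trans ltr01).
  have F1x : 0 <= F1 (- x).
    by have [_ _ _ +] := double_well_derive_sign (- x); apply; exact: lt_le_trans x1M Mx.
  by have := growth (- x); rewrite gtr0_norm// ger0_norm// lerN2; apply.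
- move=> x y xy yx1; apply: double_well_incr_right; last by rewrite lerN2.
  by rewrite lerNr.
- move=> x y x1x xy y0; apply: double_well_decr_right.
  + by rewrite oppr_ge0.
  + by rewrite lerN2.
  + by rewrite lerNl.
Qed.

(** Outside [- M, M] the bound |F'| >= 2 |x| makes F - x^2 monotone away from the origin; inside,
    [F] is at least [F x0]. A Gaussian then dominates exp(- F). *)
Lemma double_well_quadratic : exists C, forall x, x ^+ 2 - C <= F x.
Proof.
have [s [M [s1 M1 Mx0 x1M growth]]] := double_well_growth.
have M0 : 0 < M := lt_le_trans ltr01 M1.
pose g x := F x - x ^+ 2.
have dg (x : R) : is_derive x 1 g (F1 x - 2 * x).
  apply: (is_derive_eq (is_deriveB (dF x)
    (is_deriveM (is_derive_id x 1) (is_derive_id x 1)))).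
  by rewrite /GRing.scale/=; ring.
have gR x : M <= x -> g M <= g x.
  move=> Mx; apply: (derive_ge0_le dg Mx) => c /andP[Mc _].
  have F1c : 0 <= F1 c.
    by have [_ _ _ +] := double_well_derive_sign c; apply; exact: lt_trans x1M Mc.
  have := growth c; rewrite (gtr0_norm (lt_trans M0 Mc)) => /(_ (ltW Mc))[_].
  by rewrite ger0_norm// subr_ge0.
have gL x : x <= - M -> g (- M) <= g x.
  move=> Mx; apply: (derive_le0_le dg Mx) => c /andP[_ cM].
  have Mc : M < - c by rewrite ltrNr.
  have c0 : c < 0 by rewrite -oppr_gt0 (lt_trans M0).
  have F1c : F1 c <= 0.
    by have [+ _ _ _] := double_well_derive_sign c; apply; exact: lt_trans cM Mx0.
  have := growth c; rewrite (ltr0_norm c0) => /(_ (ltW Mc))[_].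
  by rewrite ler0_norm//; lra.
exists (`|g M| + `|g (- M)| + `|F x0| + M ^+ 2) => x.
have [Mx|xM] := leP M x.
  have := gR _ Mx; rewrite [in leRHS]/g.
  have := ler_norm (- g M); have := normr_ge0 (g (- M)); have := normr_ge0 (F x0).
  have := sqr_ge0 M; rewrite normrN; lra.
have [Mx|xM'] := leP x (- M).
  have := gL _ Mx; rewrite [in leRHS]/g.
  have := ler_norm (- g (- M)); have := normr_ge0 (g M); have := normr_ge0 (F x0).
  have := sqr_ge0 M; rewrite normrN; lra.
have : x ^+ 2 <= M ^+ 2 by nra.
have := ler_norm (- F x0); have := normr_ge0 (g M); have := normr_ge0 (g (- M)).
have := double_well_min x; rewrite normrN; lra.
Qed.

Lemma integrable_expRN_double_well :
  lebesgue_measure.-integrable [set: R] (EFin \o (fun x => expR (- F x))).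
Proof.
have [C FC] := double_well_quadratic.
have mF : measurable_fun [set: R] (fun x => expR (- F x)).
  apply: continuous_measurable_fun => x; apply: continuous_comp.
    by apply: cvgN; exact: cts_fun.
  exact: continuous_expR.
have intG : lebesgue_measure.-integrable [set: R]
    (fun x => (expR C)%:E * (gauss_fun x)%:E)%E.
  by apply: integrableZl => //; exact: integrableT_gauss.
apply: (le_integrable _ _ _ intG) => //; first exact/measurable_EFinP.
move=> x _ /=; rewrite lee_fin normrM !ger0_norm ?expR_ge0//.
by rewrite /gauss_fun -expRD ler_expR lerNl opprD opprK addrC.
Qed.

End well.
End double_well_theory.

(** * Eigenfunction estimates for a double well *)

Section limits_at_infinity.
Context {R : realType}.
Implicit Types f : R -> R.

Lemma increasing_at_pinfty f : bounded_fun f -> {homo f : x y / x < y} ->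
  [/\ f x @[x --> +oo] --> at_pinfty f, forall x, f x <= at_pinfty f &
  forall e M, 0 < e -> exists2 x, M < x & at_pinfty f - e < f x].
Proof.
move=> [B [_ hB]] fincr.
have fnd : {homo f : x y / x <= y}.
  by move=> x y; rewrite le_eqVlt => /predU1P[->//|/fincr/ltW].
have ubf : has_ubound (range f).
  exists (B + 1) => _ [x _ <-]; apply: le_trans (ler_norm _) _.
  by apply: hB => //; rewrite ltrDl.
have cf := nondecreasing_cvgr fnd ubf.
have -> : at_pinfty f = sup (range f) by exact: cvg_lim cf.
split => // [x|e M e0]; first by apply: ub_le_sup => //; exists x.
have supf : has_sup (range f) by split => //; exists (f 0), 0.
have [_ [x _ <-] fx] := sup_adherent e0 supf.
exists (Num.max x (M + 1)); first by rewrite lt_max ltrDl ltr01 orbT.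
by apply: lt_le_trans fx _; apply: fnd; rewrite le_max lexx.
Qed.

Lemma bounded_fun_reflect f : bounded_fun f -> bounded_fun (fun x => - f (- x)).
Proof.
move=> [B [_ hB]]; exists B; split; first exact: num_real.
by move=> M BM x _ /=; rewrite normrN; exact: hB.
Qed.

Lemma at_ninfty_reflect f : bounded_fun f -> {homo f : x y / x < y} ->
  at_ninfty f = - at_pinfty (fun x => - f (- x)).
Proof.
move=> /bounded_fun_reflect bg fincr.
have gincr : {homo (fun x => - f (- x)) : x y / x < y}.
  by move=> x y xy; rewrite ltrN2 fincr// ltrN2.
have [cg _ _] := increasing_at_pinfty bg gincr.
apply: cvg_lim => //; apply/cvgNy_compNP.
rewrite (_ : f \o -%R = - (fun x => - f (- x))); first exact: cvgN.
by apply: funext => x; rewrite opprfctE opprK.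
Qed.

End limits_at_infinity.

Section eigen_estimates.
Context {R : realType}.
Variables (F : continuousType R R) (x0 x1 : R).
Hypothesis hF : double_well F x0 x1.
Local Notation F1 := (F^`()%classic).

(** The factor exp(- F / eps) puts the operator in divergence form: the derivative of the flux is
    exp(- F / eps) (eps eta'' - F' eta'), and the eigenvalue equation replaces the bracket by -
    lambda eta. *)
Lemma eigen_system_eigenfunction eps lambda eta : 0 < eps -> 0 < lambda ->
  eigenfunction F eps (- lambda) eta -> increasing_sign_change eta ->
  eigen_system F eps lambda (- at_ninfty eta) (at_pinfty eta) eta
    (fun x => eps * expR (- F x / eps) * eta^`()%classic x).
Proof.
move=> eps0 lambda0 [[dereta _] _ _ ode] [beta etaincr [r [etar _ reta]]].
have [_ ub supl] := increasing_at_pinfty beta etaincr.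
have beta' := bounded_fun_reflect beta.
have etaincr' : {homo (fun x => - eta (- x)) : x y / x < y}.
  by move=> x y xy; rewrite ltrN2 etaincr// ltrN2.
have [_ lb infl] := increasing_at_pinfty beta' etaincr'.
have nE := at_ninfty_reflect beta etaincr.
have dwt (x : R) := is_derive_expRN_scale eps (double_well_is_derive hF x).
have d1 (x : R) : is_derive x 1 eta (eta^`()%classic x).
  by apply: DeriveDef; [exact: (dereta 0%N)|rewrite derive1E].
have d2 (x : R) : is_derive x 1 (eta^`()%classic) (eta^`(2)%classic x).
  by apply: DeriveDef; [exact: (dereta 1%N)|rewrite -derive1E].
split => //.
- by rewrite oppr_gt0 nE oppr_lt0 (lt_le_trans _ (lb (1 - r)))// oppr_gt0
    etar// opprB gtrBl.
- by apply: lt_le_trans (ub (r + 1)); apply: reta; rewrite ltrDl.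
- move=> x; apply: (is_derive_eq (d1 x)).
  have E0 : expR (- F x / eps) * expR (F x / eps) = 1.
    by rewrite -expRD mulNr addNr expR0.
  have -> : eps * expR (- F x / eps) * eta^`()%classic x * expR (F x / eps) / eps =
    eps / eps * (expR (- F x / eps) * expR (F x / eps)) * eta^`()%classic x by ring.
  by rewrite E0 divff ?gt_eqF// !mul1r.
- move=> x; have h := is_deriveZ eps (is_deriveM (dwt x) (d2 x)).
  rewrite (_ : (fun _ => _) = eps \*: ((fun y => expR (- F y / eps)) * eta^`()%classic)).
    apply: (is_derive_eq h).
    have := ode x; rewrite /diffusion mulNr => odex.
    rewrite /GRing.scale/=.
    have -> : eps * (expR (- F x / eps) * eta^`(2)%classic x + eta^`()%classic x *
       - (F1 x / eps * expR (- F x / eps))) = expR (- F x / eps) *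
       (eps * eta^`(2)%classic x - (eps / eps) * F1 x * eta^`()%classic x) by ring.
    by rewrite divff ?gt_eqF// mul1r odex; ring.
  by apply: funext => y; rewrite -mulrA.
- by move=> x; rewrite opprK nE lerNl; have := lb (- x); rewrite opprK.
- move=> e M e0; have [x Mx lx] := infl e (- M) e0.
  exists (- x); first by rewrite ltrNl.
  by rewrite opprK nE -ltrN2 opprD opprK.
Qed.

Lemma double_well_eigen_estimates : exists C c K, [/\ 0 < C, 0 < c, 0 < K &
  forall eps lambda n m eta J, eps <= 1 ->
  eigen_system F eps lambda n m eta J ->
  [/\ lambda / eps <= C * expR (- (c / eps)),
      eta x0 + n <= n * (lambda / eps) * K,
      m - eta x1 <= m * (lambda / eps) * K &
      forall x, x0 <= x -> x <= 0 ->
        eta x - eta x0 <= n * (lambda / eps) * K * expR ((F x - F x0) / eps)]].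
Proof.
have [s [M [s1 M1 Mx0 x1M growth]]] := double_well_growth hF.
have {}growth x Mx := proj1 (growth x Mx).
have LL := left_well_double_well hF s1 M1 Mx0 growth.
have LR := left_well_double_well_reflect hF s1 M1 x1M growth.
have x0_lt0 := dw_x0_lt0 hF; have x1_gt0 := dw_x1_gt0 hF.
(* [eigenvalue_bound] is applied at one quarter and one half of the way from the saddle to a
   minimum; these drops of [F] give its exponents, and [CR], [CL] its prefactors. *)
pose cR := F (x1 / 4) - F (x1 / 2).
pose cL := F (x0 / 4) - F (x0 / 2).
have cR0 : 0 < cR.
  by rewrite subr_gt0; apply: (dw_decr_right hF); rewrite ?in_itv/=; lra.
have cL0 : 0 < cL.
  by rewrite subr_gt0; apply: (dw_incr_left hF); rewrite ?in_itv/=; lra.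
pose CR := (x1 / 4 * (x1 / 2))^-1.
pose CL := (x0 / 4 * (x0 / 2))^-1.
have CR0 : 0 < CR by rewrite invr_gt0; nra.
have CL0 : 0 < CL by rewrite invr_gt0; nra.
pose K1 := (s - 1)^-1 + M * (M + 1).
pose K2 := M * (2 * M + 1).
have K10 : 0 < K1.
  by rewrite addr_gt0 ?invr_gt0 ?subr_gt0// mulr_gt0//; lra.
have K20 : 0 < K2 by rewrite mulr_gt0//; lra.
exists (CL + CR), (Num.min cL cR), (K1 + K2); split.
- exact: addr_gt0.
- by rewrite lt_min cL0.
- exact: addr_gt0.
move=> eps lambda n m eta J eps1 ES.
have ES' := eigen_system_reflect ES.
have eps0 := es_eps ES; have n0 := es_n ES; have m0 := es_m ES.
have le0 : 0 < lambda / eps by rewrite divr_gt0// (es_lambda ES).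
have nle0 : 0 <= n * (lambda / eps) by rewrite ltW// mulr_gt0.
have mle0 : 0 <= m * (lambda / eps) by rewrite ltW// mulr_gt0.
split.
- have cmin (a : R) : Num.min cL cR <= a ->
      expR (- (a / eps)) <= expR (- (Num.min cL cR / eps)).
    by move=> ca; rewrite ler_expR lerN2 ler_pM2r ?invr_gt0.
  (* If [eta 0 >= 0], the increasing [eta] is nonnegative on the right half-line; otherwise the
     reflected eigenfunction is. *)
  have [eta0|eta0] := leP 0 (eta 0).
  + apply: (@le_trans _ _ (CR * expR (- (cR / eps)))); last first.
      apply: ler_pM; rewrite ?expR_ge0 ?(ltW CR0)//; first by rewrite lerDr ltW.
      by apply: cmin; rewrite ge_min lexx orbT.
    rewrite ler_pdivlMl; last by nra.
    have := @eigenvalue_bound R F eta J eps lambda n m ES (x1 / 4) (x1 / 2) x1.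
    rewrite (_ : x1 - x1 / 2 = x1 / 2); last by lra.
    move=> h; rewrite mulrC; apply: h => //; try lra.
    exact: (double_well_decr_right hF).
  + apply: (@le_trans _ _ (CL * expR (- (cL / eps)))); last first.
      apply: ler_pM; rewrite ?expR_ge0 ?(ltW CL0)//; first by rewrite lerDl ltW.
      by apply: cmin; rewrite ge_min lexx.
    rewrite ler_pdivlMl; last by nra.
    have := @eigenvalue_bound R _ _ _ eps lambda m n ES' (- x0 / 4) (- x0 / 2) (- x0).
    rewrite (_ : - x0 - - x0 / 2 = - x0 / 2); last by lra.
    rewrite (_ : - x0 / 4 * (- x0 / 2) = x0 / 4 * (x0 / 2)); last by lra.
    rewrite !mulNr !opprK oppr0 => h; rewrite mulrC; apply: h => //; try lra.
      move=> x y x_ge0 xy yx0; apply: (double_well_incr_left hF); lra.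
- apply: le_trans (eigen_system_well ES LL eps1) _.
  by rewrite ler_wpM2l// lerDl ltW.
(* The estimate at the right minimum is the one at a left minimum for the reflected system. *)
- have := eigen_system_well ES' LR eps1; rewrite opprK addrC.
  move/le_trans; apply.
  by rewrite ler_wpM2l// lerDl ltW.
- move=> x x0x x_le0; apply: le_trans (eigen_system_saddle ES LL eps1 x0x x_le0) _.
  by rewrite ler_wpM2r ?expR_ge0// ler_wpM2l// lerDr ltW.
Qed.

End eigen_estimates.

(** * The Gibbs measure and Laplace's method *)

Section integral_density.
Local Open Scope ereal_scope.
Context d (T : measurableType d) (R : realType).
Variables (m nu : {measure set T -> \bar R}) (k : T -> R).
Hypothesis mk : measurable_fun [set: T] k.
Hypothesis k0 : forall x, (0 <= k x)%R.
Hypothesis nuE : forall A, measurable A -> nu A = \int[m]_(x in A) (k x)%:E.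
Variables (D : set T) (mD : measurable D).

Let integral_density_indic E : measurable E ->
  \int[nu]_(x in D) (\1_E x)%:E = \int[m]_(x in D) ((\1_E x)%:E * (k x)%:E).
Proof.
move=> mE; rewrite integral_indic// nuE; last exact: measurableI.
rewrite setIC integral_mkcondr; apply: eq_integral => x _.
by rewrite patchE indicE; case: ifPn => _; rewrite ?mul1e ?mul0e.
Qed.

Import HBNNSimple.

Let integral_density_nnsfun (h : {nnsfun T >-> R}) :
  \int[nu]_(x in D) (h x)%:E = \int[m]_(x in D) ((h x)%:E * (k x)%:E).
Proof.
have mkD : measurable_fun D (fun x => (k x)%:E).
  by apply/measurable_EFinP; exact: measurable_funTS.
under [LHS]eq_integral do rewrite fimfunE -fsumEFin//.
rewrite [LHS]ge0_integral_fsum//; last 2 first.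
  - by move=> r; exact/measurable_EFinP/measurableT_comp.
  - by move=> n x _; rewrite EFinM nnfun_muleindic_ge0.
under [RHS]eq_integral.
  move=> x xD; rewrite fimfunE -fsumEFin// ge0_mule_fsuml; last first.
    by move=> r; rewrite EFinM nnfun_muleindic_ge0.
  over.
rewrite [RHS]ge0_integral_fsum//; last 2 first.
  - move=> r; apply: emeasurable_funM => //.
    by apply/measurable_EFinP/measurableT_comp => //.
  - move=> n x _; apply: mule_ge0; last by rewrite lee_fin.
    by rewrite EFinM nnfun_muleindic_ge0.
apply: eq_fsbigr => r _; rewrite integralZl_indic_nnsfun// integral_density_indic//.
(* The scalar comes out of the integral by [ge0_integralZl] for [r >= 0]; a negative [r] is not a
   value of [h], and both sides vanish. *)
have [r0|r0] := leP 0%R r.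
  rewrite -ge0_integralZl//.
  - by apply: eq_integral => x _; rewrite EFinM muleA.
  - apply: emeasurable_funM => //.
    by apply/measurable_EFinP; exact: measurable_indic.
  - by move=> x _; rewrite mule_ge0 ?lee_fin.
rewrite preimage_nnfun0//.
rewrite integral0_eq ?mule0; last by move=> x _; rewrite indic0 mul0e.
by rewrite integral0_eq// => x _; rewrite indic0 mulr0 mul0e.
Qed.

Lemma ge0_integral_density (f : T -> \bar R) : measurable_fun D f ->
  (forall x, D x -> 0 <= f x) ->
  \int[nu]_(x in D) f x = \int[m]_(x in D) (f x * (k x)%:E).
Proof.
move=> mf f0; pose f_ := nnsfun_approx mD mf.
have mkD : measurable_fun D (fun x => (k x)%:E).
  by apply/measurable_EFinP; exact: measurable_funTS.
transitivity (limn (fun n => \int[nu]_(x in D) (f_ n x)%:E)).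
  rewrite -monotone_convergence//=.
  - apply: eq_integral => x /[!inE] xD; apply/esym/cvg_lim => //=.
    exact: cvg_nnsfun_approx.
  - by move=> n; apply: measurableT_comp => //; exact: measurable_funTS.
  - by move=> n x _; rewrite lee_fin.
  - by move=> x _ a b ab; rewrite lee_fin//; exact/lefP/nd_nnsfun_approx.
rewrite (_ : \int[m]_(x in D) _ =
    limn (fun n => \int[m]_(x in D) ((f_ n x)%:E * (k x)%:E))); last first.
  rewrite -monotone_convergence//=.
  - apply: eq_integral => x /[!inE] xD; apply/esym/cvg_lim => //=.
    apply: cvgeZr => //; exact: cvg_nnsfun_approx.
  - move=> n; apply: emeasurable_funM => //.
    by apply/measurable_EFinP; exact: measurable_funTS.
  - by move=> n x _; rewrite mule_ge0 ?lee_fin.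
  - move=> x _ a b ab; rewrite lee_wpmul2r ?lee_fin//.
    exact/lefP/nd_nnsfun_approx.
by congr (limn _); apply/funext => n /=; rewrite integral_density_nnsfun.
Qed.

End integral_density.

Section gibbs_theory.
Context {R : realType}.
Variables (F : continuousType R R) (x0 x1 : R).
Hypothesis hF : double_well F x0 x1.

Definition gibbs_mass (eps : R) (A : set R) : R :=
  \int[lebesgue_measure]_(x in A) gibbs_weight F eps x.

Lemma measurable_gibbs_weight eps :
  measurable_fun [set: R] (gibbs_weight F eps).
Proof.
apply: continuous_measurable_fun => x.
apply: (@continuous_comp _ _ _ (fun y => - F y / eps) expR); last first.
  exact: continuous_expR.
by apply: cvgM; [apply: cvgN; exact: cts_fun|exact: cvg_cst].
Qed.

(** For [eps <= 1], dividing [F - F x0 >= 0] by [eps] can only increase it, so the weight is at most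
    a constant times exp(- F). *)
Lemma integrable_gibbs_weight eps (A : set R) : 0 < eps -> eps <= 1 ->
  measurable A ->
  lebesgue_measure.-integrable A (EFin \o gibbs_weight F eps).
Proof.
move=> eps0 eps1 mA.
suff : lebesgue_measure.-integrable [set: R] (EFin \o gibbs_weight F eps).
  by apply: integrableS.
have intF : lebesgue_measure.-integrable [set: R]
    (fun x => (expR (F x0 - F x0 / eps))%:E * (expR (- F x))%:E)%E.
  by apply: integrableZl => //; exact: integrable_expRN_double_well hF.
apply: (le_integrable _ _ _ intF) => //.
  by apply/measurable_EFinP; exact: measurable_gibbs_weight.
move=> x _ /=; rewrite lee_fin normrM !ger0_norm ?expR_ge0//.
rewrite /gibbs_weight -expRD ler_expR.
have : F x - F x0 <= (F x - F x0) / eps.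
  by rewrite ler_peMr ?subr_ge0 ?(double_well_min hF)// invf_ge1.
by rewrite mulrBl mulNr; lra.
Qed.

Section fixed_eps.
Variable eps : R.
Hypotheses (eps0 : 0 < eps) (eps1 : eps <= 1).

Lemma gibbs_fin A : measurable A -> gibbs F eps A = (gibbs_mass eps A)%:E.
Proof.
move=> mA; rewrite /gibbs_mass /Rintegral fineK//.
by apply: integrable_fin_num => //; exact: integrable_gibbs_weight.
Qed.

Lemma le_gibbs_mass (A B : set R) : measurable A -> measurable B ->
  A `<=` B -> gibbs_mass eps A <= gibbs_mass eps B.
Proof.
move=> mA mB AB; rewrite -lee_fin -!gibbs_fin//.
by apply: le_measure; rewrite ?inE.
Qed.

Lemma gibbs_mass_itv_ge (a b c : R) : a <= b ->
  (forall x, a < x < b -> F x <= c) ->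
  (b - a) * expR (- c / eps) <= gibbs_mass eps `]a, b[.
Proof.
move=> ab Fc.
have leb : lebesgue_measure (`]a, b[%classic : set R) = (b - a)%:E.
  rewrite lebesgue_measure_itv/= lte_fin; move: ab; rewrite le_eqVlt.
  by case/predU1P => [->|->//]; rewrite ltxx subrr.
have mab : fine (lebesgue_measure (`]a, b[%classic : set R)) = b - a.
  by rewrite leb.
rewrite mulrC -mab -Rintegral_cst; last exact: measurable_itv.
apply: le_Rintegral => //.
- apply/integrableP; split; first exact: measurable_cst.
  rewrite integral_cst//; apply: lte_mul_pinfty => //.
  by rewrite [X in (X < _)%E]leb ltry.
- exact: integrable_gibbs_weight.
- move=> x /=; rewrite in_itv/= => axb.
  by rewrite /gibbs_weight ler_expR ler_pM2r ?invr_gt0// lerN2 Fc.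
Qed.

Lemma gibbs_mass_gt0 (a b : R) : a < b -> 0 < gibbs_mass eps `]a, b[.
Proof.
move=> ab; have [c cab Fc] : exists2 c, c \in `[a, b] &
    forall t, t \in `[a, b] -> F t <= F c.
  by apply: EVT_max; [exact: ltW|apply: continuous_subspaceT => x; exact: cts_fun].
apply: lt_le_trans (gibbs_mass_itv_ge (c := F c) (ltW ab) _).
  by rewrite mulr_gt0 ?subr_gt0// expR_gt0.
by move=> x /andP[ax xb]; apply: Fc; rewrite in_itv/= !ltW.
Qed.

Lemma gibbs_massT_gt0 : 0 < gibbs_mass eps [set: R].
Proof.
by apply: lt_le_trans (gibbs_mass_gt0 (@ltr01 R)) _; exact: le_gibbs_mass.
Qed.

Lemma varpiE A : measurable A ->
  varpi F eps A = (gibbs_mass eps A / gibbs_mass eps [set: R])%:E.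
Proof.
move=> mA; rewrite /varpi/= /mnormalize/= gibbs_fin// orbF eqe gt_eqF ?gibbs_massT_gt0//.
by rewrite gibbs_fin.
Qed.

(** The integrand, which has the shape of the bound in [eigen_system_saddle], cancels the Gibbs
    density up to a constant; only the length [- z] of the interval remains. *)
Lemma integral_varpi_expR (z : R) : z <= 0 ->
  \int[varpi F eps]_(x in `[z, 0]) expR ((F x - F z) / eps) =
  - z * expR (- F z / eps) / gibbs_mass eps [set: R].
Proof.
move=> z0; rewrite /Rintegral.
pose k x := gibbs_weight F eps x / gibbs_mass eps [set: R].
have ZT := gibbs_massT_gt0.
have leb : lebesgue_measure (`[z, 0]%classic : set R) = (- z)%:E.
  rewrite lebesgue_measure_itv/= lte_fin; move: z0; rewrite le_eqVlt.
  by case/predU1P => [->|->]; [rewrite ltxx oppr0|rewrite -EFinB sub0r].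
have mf : measurable_fun [set: R] (fun x => expR ((F x - F z) / eps)).
  apply: continuous_measurable_fun => x.
  apply: (@continuous_comp _ _ _ (fun y => (F y - F z) / eps) expR); last first.
    exact: continuous_expR.
  apply: cvgM; last exact: cvg_cst.
  by apply: cvgB; [exact: cts_fun|exact: cvg_cst].
rewrite (@ge0_integral_density _ _ _ lebesgue_measure (varpi F eps) k); first last.
- by move=> x _; rewrite lee_fin expR_ge0.
- by apply/measurable_EFinP; exact: measurable_funTS.
- exact: measurable_itv.
- move=> A mA; rewrite [LHS](varpiE mA) /k.
  under eq_integral do rewrite mulrC EFinM.
  rewrite integralZl//; last exact: integrable_gibbs_weight.
  by rewrite mulrC EFinM -gibbs_fin.
- by move=> x; rewrite divr_ge0 ?expR_ge0// ltW.
- by apply: measurable_funM => //; exact: measurable_gibbs_weight.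
under eq_integral => x _.
  rewrite -EFinM /k /gibbs_weight mulrA -expRD -mulrDl addrAC addrN sub0r; over.
rewrite integral_cst; last exact: measurable_itv.
by rewrite [X in (_ * X)%E]leb -EFinM/= mulrC mulrA.
Qed.

End fixed_eps.

(** By continuity [F < F z + kappa] on a ball around [z]; [l] is the length of its part in ]a, b[,
    so it does not depend on [eps]. The point [z] may be an endpoint, as for a window starting at
    [x1]. *)
Lemma gibbs_mass_near_min (z a b kappa : R) : a < b -> a <= z <= b ->
  0 < kappa -> exists2 l, 0 < l & forall eps, 0 < eps -> eps <= 1 ->
    l * expR (- (F z + kappa) / eps) <= gibbs_mass eps `]a, b[.
Proof.
move=> ab /andP[az zb] kappa0.
have : \forall x \near z, F x < F z + kappa.
  have cF : F x @[x --> z] --> F z by exact: cts_fun.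
  by have := cvgr_lt (F z) cF (F z + kappa); apply; rewrite ltrDl.
move/nbhs_ballP => [e /= e0 he].
pose a' := Num.max a (z - e); pose b' := Num.min b (z + e).
have ab' : a' < b'.
  by rewrite /a' /b' gt_max !lt_min ab; apply/and3P; split; lra.
exists (b' - a'); first by rewrite subr_gt0.
move=> eps eps0 eps1; apply: (@le_trans _ _ (gibbs_mass eps `]a', b'[)).
  apply: gibbs_mass_itv_ge => //; first exact: ltW.
  move=> x; rewrite /a' /b' gt_max lt_min => /andP[/andP[_ zx] /andP[_ xz]].
  apply/ltW/he; rewrite /ball/= ltr_norml; lra.
apply: le_gibbs_mass => // x /=; rewrite !in_itv/=.
by rewrite /a' /b' gt_max lt_min => /andP[/andP[-> _] /andP[-> _]].
Qed.

(** On [A], as [eps <= 1], the weight is at most exp(- (F z + kappa) / eps) times the integrable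
    factor exp(F z + kappa - F). The window ]a, b[ has mass at least of order exp(- (F z + kappa /
    2) / eps), and half of [kappa] is left as a gain. *)
Lemma laplace_ratio (A : set R) (z a b kappa : R) : measurable A ->
  a < b -> a <= z <= b -> 0 < kappa -> (forall x, A x -> F z + kappa <= F x) ->
  exists2 C, 0 < C & forall eps, 0 < eps -> eps <= 1 ->
    fine (varpi F eps A) <=
    C * expR (- (kappa / 2 / eps)) * fine (varpi F eps `]a, b[%classic).
Proof.
move=> mA ab azb kappa0 FA.
have k20 : 0 < kappa / 2 by rewrite divr_gt0.
have [l l0 hl] := gibbs_mass_near_min ab azb k20.
pose C0 := expR (F z + kappa) * gibbs_mass 1 [set: R].
have C00 : 0 < C0 by rewrite mulr_gt0 ?expR_gt0// gibbs_massT_gt0.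
exists (C0 / l); first by rewrite divr_gt0.
move=> eps eps0 eps1; rewrite !varpiE//= mulrA.
rewrite ler_pM2r ?invr_gt0 ?gibbs_massT_gt0//.
apply: (@le_trans _ _ (C0 / l * expR (- (kappa / 2 / eps)) *
   (l * expR (- (F z + kappa / 2) / eps)))); last first.
  by rewrite ler_wpM2l ?hl// mulr_ge0 ?expR_ge0// divr_ge0 ?ltW.
rewrite (_ : _ * _ = C0 * expR (- (F z + kappa) / eps)); last first.
  rewrite mulrACA mulfVK ?gt_eqF// -expRD; congr (_ * expR _).
  by field; rewrite gt_eqF.
rewrite /C0 mulrAC -expRD.
have := @integrable_gibbs_weight 1 A ltr01 (lexx 1) mA => intA.
apply: (@le_trans _ _ (expR (F z + kappa - (F z + kappa) / eps) * gibbs_mass 1 A)).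
  rewrite /gibbs_mass -RintegralZl//.
  apply: le_Rintegral => //; first exact: integrable_gibbs_weight.
    rewrite (_ : _ \o _ = fun x => (expR (F z + kappa - (F z + kappa) / eps))%:E *
      (gibbs_weight F 1 x)%:E)%E//; exact: integrableZl.
  move=> x Ax; rewrite /gibbs_weight -expRD ler_expR divr1.
  have : F x - (F z + kappa) <= (F x - (F z + kappa)) / eps.
    by rewrite ler_peMr ?subr_ge0 ?FA// invf_ge1.
  by rewrite mulrBl mulNr; lra.
by rewrite mulNr ler_wpM2l ?expR_ge0// le_gibbs_mass.
Qed.

End gibbs_theory.

(** * Concentration in the small noise limit *)

Section bounded_integrals.
Context d (T : measurableType d) (R : realType).
Variable m : {finite_measure set T -> \bar R}.

Lemma finite_measure_bounded_integrable (f : T -> R) (D : set T) (B : R) :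
  measurable D -> measurable_fun D f -> (forall x, D x -> `|f x| <= B) ->
  m.-integrable D (EFin \o f).
Proof.
move=> mD mf fB; apply: measurable_bounded_integrable => //.
  by rewrite ltey_eq fin_num_measure.
exists B; split; first exact: num_real.
by move=> M BM x Dx /=; rewrite (le_trans (fB _ Dx))// ltW.
Qed.

Lemma Rintegral_le_cst (f : T -> R) (D : set T) (c : R) :
  measurable D -> m.-integrable D (EFin \o f) -> (forall x, D x -> f x <= c) ->
  \int[m]_(x in D) f x <= c * fine (m D).
Proof.
move=> mD intf fc; rewrite -Rintegral_cst//; apply: le_Rintegral => //.
by apply: (@finite_measure_bounded_integrable _ _ `|c|).
Qed.

Lemma Rintegral_ge_cst (f : T -> R) (D : set T) (c : R) :
  measurable D -> m.-integrable D (EFin \o f) -> (forall x, D x -> c <= f x) ->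
  c * fine (m D) <= \int[m]_(x in D) f x.
Proof.
move=> mD intf fc; rewrite -Rintegral_cst//; apply: le_Rintegral => //.
by apply: (@finite_measure_bounded_integrable _ _ `|c|).
Qed.

Lemma Rintegral_subset_le (f : T -> R) (A D : set T) :
  measurable A -> measurable D -> A `<=` D -> m.-integrable D (EFin \o f) ->
  (forall x, D x -> 0 <= f x) -> \int[m]_(x in A) f x <= \int[m]_(x in D) f x.
Proof.
move=> mA mD AD intf f0; apply: fine_le.
- by apply: integrable_fin_num => //; exact: integrableS intf.
- exact: integrable_fin_num.
- by apply: ge0_subset_integral => //; case/integrableP: intf.
Qed.

(** The deviation of [f] from [v] is at most [e] on [A] and at most [2 * B] off [A]. The weight [k]
    lets one statement serve both a density against [varpi] and an event of the probability space,
    where [k = 1]. *)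
Lemma weighted_mean_dist (k f : T -> R) (D A : set T) (B e v : R) :
  measurable D -> measurable A -> measurable_fun D f ->
  m.-integrable D (EFin \o k) -> (forall x, D x -> 0 <= k x) ->
  (forall x, D x -> `|f x| <= B) -> `|v| <= B -> 0 <= e ->
  (forall x, D x -> A x -> `|f x - v| <= e) ->
  `| \int[m]_(x in D) (f x * k x) - v * \int[m]_(x in D) k x | <=
  e * \int[m]_(x in D) k x + 2 * B * \int[m]_(x in D `&` ~` A) k x.
Proof.
move=> mD mA mf intk k0 fB vB e0 fve.
have mk : measurable_fun D k by case/integrableP: intk => /measurable_EFinP.
have B0 : 0 <= B := le_trans (normr_ge0 _) vB.
have mCA : measurable (~` A) by exact: measurableC.
have intfk : m.-integrable D (EFin \o (fun x => f x * k x)).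
  apply: (@le_integrable _ _ _ _ _ mD _ (fun x => B%:E * (k x)%:E)%E).
  - by apply/measurable_EFinP; exact: measurable_funM.
  - move=> x Dx /=; rewrite lee_fin !normrM ler_wpM2r// (ger0_norm B0).
    exact: fB.
  - exact: integrableZl.
have intvk : m.-integrable D (EFin \o (fun x => v * k x)).
  by rewrite (_ : _ \o _ = fun x => v%:E * (k x)%:E)%E//; exact: integrableZl.
have intek : m.-integrable D (EFin \o (fun x => e * k x)).
  by rewrite (_ : _ \o _ = fun x => e%:E * (k x)%:E)%E//; exact: integrableZl.
have kA x : (k \_ (~` A)) x = k x * \1_(~` A) x by rewrite patch_indic.
have mkA : measurable_fun D (k \_ (~` A)).
  apply/measurable_restrict => //.
  by apply: measurable_funS mk => //; exact: subIsetr.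
have intkA : m.-integrable D (EFin \o (k \_ (~` A))).
  apply: (@le_integrable _ _ _ _ _ mD _ (EFin \o k)) => //.
    exact/measurable_EFinP.
  move=> x Dx; rewrite /= kA lee_fin normrM ler_piMr// indicE.
  by case: (_ \in _); rewrite ?normr1 ?normr0.
have intBk : m.-integrable D (EFin \o (fun x => 2 * B * (k \_ (~` A)) x)).
  rewrite (_ : _ \o _ = fun x => (2 * B)%:E * ((k \_ (~` A)) x)%:E)%E//.
  exact: integrableZl.
have intd : m.-integrable D (EFin \o (fun x => f x * k x - v * k x)).
  exact: (integrableB mD intfk intvk).
rewrite -RintegralZl// -RintegralB//.
apply: (le_trans (le_normr_Rintegral mD intd)).
rewrite Rintegral_mkcondr -RintegralZl// -RintegralZl// -RintegralD//.
apply: le_Rintegral => //.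
- exact: (integrable_abse intd).
- exact: (integrableD mD intek intBk).
move=> x Dx; rewrite -mulrBl normrM (ger0_norm (k0 _ Dx)) kA indicE.
case: (boolP (x \in _)); rewrite ?notin_setE ?inE => Ax; rewrite ?mulr1.
  apply: ler_wpDl; first by rewrite mulr_ge0 ?k0.
  rewrite ler_wpM2r ?k0// (le_trans (ler_normB _ _))//.
  by have := fB _ Dx; lra.
rewrite !mulr0 addr0 ler_wpM2r ?k0// fve//.
by apply: contrapT.
Qed.

End bounded_integrals.

Section small_noise.
Context {R : realType}.

(** Squeezed by [eps / c], since exp(c / eps) >= 1 + c / eps. *)
Lemma expRN_inv_cvg0 (c : R) : 0 < c ->
  expR (- (c / eps)) @[eps --> 0^'+] --> (0 : R).
Proof.
move=> c0; apply: (@squeeze_cvgr _ _ _ _ (fun=> 0) (fun eps => eps / c)).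
- near=> eps; rewrite expR_ge0/=.
  have eps0 : 0 < eps by near: eps; exact: nbhs_right_gt.
  rewrite expRN -(invrK (eps / c)) lef_pV2 ?posrE ?expR_gt0 ?invr_gt0 ?divr_gt0//.
  rewrite invf_div; apply: le_trans (expR_ge1Dx _).
  by rewrite lerDr.
- exact: cvg_cst.
- rewrite -[X in _ --> X](mul0r c^-1); apply: cvgM; last exact: cvg_cst.
  by apply: cvg_at_right_filter; exact: cvg_id.
Unshelve. all: by end_near. Qed.

Variables (F : continuousType R R) (x0 x1 : R).
Hypothesis hF : double_well F x0 x1.

(** Laplace's method at the deeper minimum [x0]: [F] is at least [F x1] on the right half-line,
    whence the gap [F x1 - F x0]. *)
Lemma varpi_right_bound : exists C c, [/\ 0 < C, 0 < c &
  forall eps, 0 < eps -> eps <= 1 ->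
    fine (varpi F eps [set x | 0 <= x]) <= C * expR (- (c / eps))].
Proof.
have kappa0 : 0 < F x1 - F x0 by rewrite subr_gt0 (dw_deeper hF).
have mA : measurable ([set x | 0 <= x] : set R).
  by rewrite -set_itvcy; exact: measurable_itv.
have [| | |C C0 hC] := @laplace_ratio R F x0 x1 hF _ x0 (x0 - 1) (x0 + 1) _ mA _ _ kappa0.
- by rewrite ltrBlDr -addrA ltrDl.
- by rewrite gerBl lerDl ler01.
- by move=> x /= x_ge0; rewrite subrKC (double_well_min_right hF).
exists C, ((F x1 - F x0) / 2); split => // [|eps eps0 eps1].
  by rewrite divr_gt0.
apply: le_trans (hC _ eps0 eps1) _; rewrite ler_piMr ?mulr_ge0 ?expR_ge0 ?(ltW C0)//.
by rewrite -lee_fin fineK ?fin_num_measure// probability_le1.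
Qed.

Lemma double_well_strict_right delta : 0 < delta -> delta <= x1 / 2 ->
  exists2 kappa, 0 < kappa & forall x, 0 < x -> delta <= `|x - x1| ->
    F x1 + kappa <= F x.
Proof.
move=> d0 dx1; have x1_gt0 := dw_x1_gt0 hF.
(* The strict assumptions hold on open intervals, which exclude [x1]; intermediate points at
   distance [delta / 2] restore strictness. *)
have kL : 0 < F (x1 - delta) - F x1.
  rewrite subr_gt0; apply: (@le_lt_trans _ _ (F (x1 - delta / 2))).
    by apply: (double_well_min_right hF); lra.
  by apply: (dw_decr_right hF); rewrite ?in_itv/=; lra.
have kR : 0 < F (x1 + delta) - F x1.
  rewrite subr_gt0; apply: (@le_lt_trans _ _ (F (x1 + delta / 2))).
    by apply: (double_well_min_right hF); lra.
  by apply: (dw_incr_right hF); rewrite ?in_itv/= ?andbT; lra.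
exists (Num.min (F (x1 - delta) - F x1) (F (x1 + delta) - F x1)).
  by rewrite lt_min kL.
move=> x x_gt0; rewrite -lerBrDl ge_min lerD2r; have [xx1|x1x] := leP x x1.
  rewrite ler0_norm ?subr_le0// => dx; apply/orP; left.
  by apply: (double_well_decr_right hF); lra.
rewrite gtr0_norm ?subr_gt0// => dx; apply/orP; right; rewrite lerD2r.
by apply: (double_well_incr_right hF); lra.
Qed.

(** The comparison window lies on the right of [x1], where the increasing [eta] is at least
    [eta x1]; this lets the bound pass to the densities [1 + xi * eta] with [xi > 0]. *)
Lemma varpi_right_concentration delta : 0 < delta -> delta <= x1 / 2 ->
  exists C c, [/\ 0 < C, 0 < c & forall eps, 0 < eps -> eps <= 1 ->
    fine (varpi F eps [set x | 0 < x /\ delta <= `|x - x1|]) <=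
    C * expR (- (c / eps)) * fine (varpi F eps `]x1, x1 + delta[%classic)].
Proof.
move=> d0 dx1; have [kappa kappa0 hk] := double_well_strict_right d0 dx1.
have mA : measurable ([set x | 0 < x /\ delta <= `|x - x1|] : set R).
  rewrite (_ : [set _ | _] = `]0, +oo[%classic `&`
      (`]-oo, x1 - delta]%classic `|` `[x1 + delta, +oo[%classic)).
    by apply: measurableI => //; apply: measurableU; exact: measurable_itv.
  apply/seteqP; split => x /=; rewrite !in_itv/= ?andbT.
    move=> [-> dx]; split => //; move: dx; rewrite ler_normr => /orP[dx|dx].
      by right; lra.
    by left; lra.
  by move=> [-> [h|h]]; split => //; rewrite ler_normr; apply/orP;
    [right|left]; lra.
have [| | |C C0 hC] := @laplace_ratio R F x0 x1 hF _ x1 x1 (x1 + delta) _ mA _ _ kappa0.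
- by rewrite ltrDl.
- by rewrite lexx lerDl ltW.
- by move=> x [x_gt0 dx]; exact: hk.
by exists C, (kappa / 2); split => //; rewrite divr_gt0.
Qed.

(** Up to [x0] the integrand is at most [q]; from [x0] to 0 it grows by at most [q] times exp((F - F
    x0) / eps), whose [varpi] integral is |x0| exp(- F x0 / eps) divided by the total mass. That
    quotient is at most of order exp(c / (2 eps)), half of the exponent that the bound on
    [lambda / eps] provides. *)
Lemma varpi_left_excess : exists C c, [/\ 0 < C, 0 < c &
  forall eps lambda n m eta J, eps <= 1 ->
  eigen_system F eps lambda n m eta J ->
  (varpi F eps).-integrable [set x | x <= 0] (EFin \o (fun x => n + eta x)) ->
  \int[varpi F eps]_(x in [set x | x <= 0]) (n + eta x) <=
  n * (C * expR (- (c / eps)))].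
Proof.
have [C [c [K [C0 c0 K0 hest]]]] := double_well_eigen_estimates hF.
have x0_lt0 := dw_x0_lt0 hF.
have c20 : 0 < c / 2 by rewrite divr_gt0.
have ab : x0 - 1 < x0 + 1 by rewrite ltrBlDr -addrA ltrDl.
have azb : x0 - 1 <= x0 <= x0 + 1 by rewrite gerBl lerDl ler01.
have [l l0 hl] := gibbs_mass_near_min hF ab azb c20.
exists (K * C * (1 - x0 / l)), (c / 2); split => //.
  rewrite !mulr_gt0// subr_gt0 (lt_trans _ ltr01)// ltr_pdivrMr// mul0r//.
move=> eps lambda n m eta J eps1 ES intf.
have eps0 := es_eps ES; have n0 := es_n ES; have l1 := es_lambda ES.
have [hl1 hl2 _ hl4] := hest _ _ _ _ _ _ eps1 ES.
pose q := n * (lambda / eps) * K.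
have q0 : 0 <= q by rewrite ltW// !mulr_gt0// invr_gt0.
have mD : measurable ([set x | x <= 0] : set R).
  by rewrite -set_itvNyc; exact: measurable_itv.
pose I := `[x0, 0]%classic : set R.
have mI : measurable I by exact: measurable_itv.
pose f x := expR ((F x - F x0) / eps).
have mf : measurable_fun [set: R] f.
  apply: continuous_measurable_fun => x.
  apply: (@continuous_comp _ _ _ (fun y => (F y - F x0) / eps) expR); last first.
    exact: continuous_expR.
  apply: cvgM; last exact: cvg_cst.
  by apply: cvgB; [exact: cts_fun|exact: cvg_cst].
have fI x : (f \_ I) x = f x * \1_I x by rewrite patch_indic.
have intfI (D : set R) : measurable D -> D `<=` [set x | x <= 0] ->
    (varpi F eps).-integrable D (EFin \o (f \_ I)).
  move=> mD' D0; apply: (@finite_measure_bounded_integrable _ _ _ _ _ _ (f 0)) => //.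
    by apply/measurable_restrict => //; exact: measurable_funTS.
  move=> x Dx; rewrite fI indicE; case: (boolP (x \in _)) => [|_]; last first.
    by rewrite mulr0 normr0 expR_ge0.
  rewrite mulr1 inE /I/= in_itv/= => /andP[x0x xle0]; rewrite ger0_norm ?expR_ge0//.
  rewrite ler_expR ler_pM2r ?invr_gt0// lerD2r.
  exact: (double_well_incr_left hF).
apply: (@le_trans _ _ (\int[varpi F eps]_(x in [set x | x <= 0])
    (q + q * (f \_ I) x))).
  apply: le_Rintegral => //.
    rewrite (_ : _ \o _ = (EFin \o cst q) \+
      (fun x => q%:E * ((f \_ I) x)%:E))%E//.
    apply: integrableD => //.
      exact: (@finite_measure_bounded_integrable _ _ _ _ _ _ `|q|).
    by apply: integrableZl => //; exact: intfI.
  move=> x /= xle0; have [xx0|x0x] := ltP x x0.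
    rewrite fI indicE memNset/=; last by rewrite /I/= in_itv/= leNgt xx0.
    rewrite !mulr0 addr0 addrC; apply: le_trans hl2; rewrite lerD2r.
    exact: (eigen_system_nondecreasing ES (ltW xx0)).
  rewrite fI indicE mem_set/= ?mulr1; last by rewrite /I/= in_itv/= x0x.
  have := hl4 _ x0x xle0; rewrite -/(f x) -/q => h.
  by move: hl2; rewrite -/q; lra.
rewrite RintegralD//; last 2 first.
- exact: (@finite_measure_bounded_integrable _ _ _ _ _ _ `|q|).
- rewrite (_ : _ \o _ = (fun x => q%:E * ((f \_ I) x)%:E))%E//.
  by apply: integrableZl => //; exact: intfI.
rewrite RintegralZl//; last exact: intfI.
rewrite -Rintegral_mkcondr setIidr; last first.
  by move=> x; rewrite /I/= in_itv/= => /andP[].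
rewrite (integral_varpi_expR hF eps0 eps1 (ltW x0_lt0)) Rintegral_cst//.
have Wle1 : fine (varpi F eps [set x | x <= 0]) <= 1.
  by rewrite -lee_fin fineK ?fin_num_measure// probability_le1.
have Zbig : expR (- F x0 / eps) / gibbs_mass F eps [set: R] <=
    l^-1 * expR (c / 2 / eps).
  rewrite ler_pdivrMr; last exact: (gibbs_massT_gt0 hF).
  rewrite mulrAC -ler_pdivrMr ?expR_gt0// -expRN -expRD.
  rewrite ler_pdivlMl//; apply: (@le_trans _ _ (gibbs_mass F eps `]x0 - 1, x0 + 1[)).
    rewrite (_ : _ - _ = - (F x0 + c / 2) / eps); first exact: hl.
    by field; rewrite gt_eqF.
  exact: (le_gibbs_mass hF).
have qle : q <= n * (K * C * expR (- (c / eps))).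
  rewrite /q -mulrA ler_pM2l// [leLHS]mulrC -mulrA ler_pM2l//.
apply: (@le_trans _ _ (q * (1 + - x0 * (l^-1 * expR (c / 2 / eps))))).
  rewrite mulrDr lerD ?ler_wpM2l// -mulrA ler_wpM2l// oppr_ge0 ltW//.
have e1 : 1 <= expR (c / 2 / eps) by rewrite -[leLHS]expR0 ler_expR ltW// divr_gt0.
have x0l : 0 <= - x0 / l by rewrite divr_ge0 ?oppr_ge0 ?(ltW x0_lt0) ?(ltW l0).
apply: (@le_trans _ _ (q * (expR (c / 2 / eps) * (1 - x0 / l)))).
  rewrite ler_wpM2l//; move: x0l e1; rewrite mulNr; nra.
apply: (@le_trans _ _ (n * (K * C * expR (- (c / eps))) *
    (expR (c / 2 / eps) * (1 - x0 / l)))).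
  rewrite ler_wpM2r// mulr_ge0 ?expR_ge0//; move: x0l; rewrite mulNr; lra.
have -> : - (c / eps) = - (c / 2 / eps) - (c / 2 / eps) by field; rewrite gt_eqF.
rewrite expRD (expRN (c / 2 / eps)).
rewrite le_eqVlt; apply/orP; left; apply/eqP; field.
by rewrite gt_eqF ?expR_gt0// gt_eqF.
Qed.

End small_noise.

(** * Conditional laws *)

Section measurable_half_lines.
Context {R : realType}.

Lemma measurable_gt0 : measurable ([set x | 0 < x] : set R).
Proof. by rewrite -set_itvoy; exact: measurable_itv. Qed.

Lemma measurable_ge0 : measurable ([set x | 0 <= x] : set R).
Proof. by rewrite -set_itvcy; exact: measurable_itv. Qed.

Lemma measurable_le0 : measurable ([set x | x <= 0] : set R).
Proof. by rewrite -set_itvNyc; exact: measurable_itv. Qed.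

Lemma measurable_lt0 : measurable ([set x | x < 0] : set R).
Proof. by rewrite -set_itvNyo; exact: measurable_itv. Qed.

End measurable_half_lines.

Section fixed_noise.
Context {R : realType}.
Variables (F : continuousType R R) (eps lambda n m : R) (eta J : R -> R).
Hypothesis ES : eigen_system F eps lambda n m eta J.
Let w := varpi F eps.
Let n0 := es_n ES.
Let m0 := es_m ES.

Lemma eigen_system_norm_le x : `|eta x| <= n + m.
Proof.
rewrite ler_norml; have := es_lb ES x; have := es_ub ES x.
by move: n0 m0; lra.
Qed.

Lemma measurable_eigen_system : measurable_fun [set: measurableTypeR R] eta.
Proof.
apply: continuous_measurable_fun.
exact: is_derive_continuous (es_eta ES).
Qed.

Lemma integrable_affine_eigen_system (a b : R) (A : set R) : measurable A ->
  w.-integrable A (EFin \o (fun x => a + b * eta x)).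
Proof.
move=> mA; apply: (@finite_measure_bounded_integrable _ _ _ _ _ _
  (`|a| + `|b| * (n + m))) => //.
  apply: measurable_funTS; apply: measurable_funD => //.
  by apply: measurable_funM => //; exact: measurable_eigen_system.
move=> x _; rewrite (le_trans (ler_normD _ _))// lerD2l normrM ler_wpM2l//.
exact: eigen_system_norm_le.
Qed.

Lemma Rintegral_affine_eigen_system (a b : R) (A : set R) : measurable A ->
  \int[w]_(x in A) (a + b * eta x) =
  a * fine (w A) + b * \int[w]_(x in A) eta x.
Proof.
move=> mA; have inteta : w.-integrable A (EFin \o eta).
  have := integrable_affine_eigen_system 0 1 mA.
  by under eq_fun do rewrite add0r mul1r.
rewrite RintegralD//; last 2 first.
- exact: (@finite_measure_bounded_integrable _ _ _ _ _ _ `|a|).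
- have := integrable_affine_eigen_system 0 b mA.
  by under eq_fun do rewrite add0r.
by rewrite Rintegral_cst// RintegralZl.
Qed.

Variable xi : R.
Hypothesis hxi : - m^-1 <= xi <= n^-1.

Lemma density_ge0 x : 0 <= 1 + xi * eta x.
Proof.
have /andP[xim xin] := hxi.
have h1 : - 1 <= xi * m by rewrite -ler_pdivrMr// mulNr mul1r.
have h2 : xi * n <= 1 by rewrite -ler_pdivlMr// div1r.
have [xi0|xi0] := leP 0 xi.
  by have := ler_wpM2l xi0 (es_lb ES x); lra.
by have := ler_wnM2l (ltW xi0) (es_ub ES x); lra.
Qed.

Hypothesis mean0 : \int[w]_x eta x = 0.

Lemma Rintegral_density : \int[w]_x (1 + xi * eta x) = 1.
Proof.
rewrite Rintegral_affine_eigen_system// mean0 mulr0 addr0 mul1r.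
by rewrite probability_setT.
Qed.

Lemma Rintegral_density_setC (A : set R) : measurable A ->
  \int[w]_(x in A) (1 + xi * eta x) = 1 - \int[w]_(x in ~` A) (1 + xi * eta x).
Proof.
move=> mA; apply/esym/eqP; rewrite subr_eq -Rintegral_setU//.
- by rewrite setUv Rintegral_density.
- exact: measurableC.
- by apply: integrable_affine_eigen_system; rewrite setUv.
- by apply/disj_setPS; rewrite setICr.
Qed.

(** The decomposition 1 + xi eta = (1 - xi n) + xi (n + eta) isolates the small excess n + eta. *)
Lemma Rintegral_density_left :
  \int[w]_(x in [set x | x <= 0]) (1 + xi * eta x) =
  fine (w [set x | x <= 0]) * (1 - xi * n) +
  xi * \int[w]_(x in [set x | x <= 0]) (n + eta x).
Proof.
have mA := @measurable_le0 R.
have -> : \int[w]_(x in [set x | x <= 0]) (n + eta x) =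
    \int[w]_(x in [set x | x <= 0]) (n + 1 * eta x).
  by apply: eq_Rintegral => x _; rewrite mul1r.
rewrite !Rintegral_affine_eigen_system//; ring.
Qed.

(* [eta] has mean zero, close to [- n] on the left and at most [m] on the
   right. *)
Lemma eigen_system_balance :
  n * fine (w [set x | x <= 0]) -
    \int[w]_(x in [set x | x <= 0]) (n + eta x) <= m.
Proof.
have mA := @measurable_le0 R.
have -> : \int[w]_(x in [set x | x <= 0]) (n + eta x) =
    \int[w]_(x in [set x | x <= 0]) (n + 1 * eta x).
  by apply: eq_Rintegral => x _; rewrite mul1r.
rewrite Rintegral_affine_eigen_system// mul1r opprD addrA subrr add0r.
have inteta (A : set R) : measurable A -> w.-integrable A (EFin \o eta).
  move=> mA'; have := integrable_affine_eigen_system 0 1 mA'.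
  by under eq_fun do rewrite add0r mul1r.
have : \int[w]_(x in [set x | x <= 0]) eta x +
    \int[w]_(x in ~` [set x | x <= 0]) eta x = 0.
  rewrite -Rintegral_setU//.
  - by rewrite setUv.
  - exact: measurableC.
  - by apply: inteta; rewrite setUv.
  - by apply/disj_setPS; rewrite setICr.
move/eqP; rewrite addrC addr_eq0 => /eqP <-.
apply: le_trans (Rintegral_le_cst (c := m) _ _ _) _.
- exact: measurableC.
- by apply: inteta; exact: measurableC.
- by move=> x _; exact: es_ub ES x.
rewrite ler_piMr ?(ltW m0)// -lee_fin fineK ?fin_num_measure ?probability_le1//.
all: exact: measurableC.
Qed.

(** As m <= 2 eta x1, the density is everywhere at most twice its value at [x1], while on the window
    it is at least that value. Since its total mass is 1, the value at [x1] times the mass of the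
    window is at most 1. *)
Lemma density_right_concentration (x1 delta r K : R) (S : set R) :
  0 <= x1 -> 0 < xi -> 0 < delta -> 0 <= r -> lambda / eps * K <= 1 / 2 ->
  m - eta x1 <= m * (lambda / eps) * K -> measurable S ->
  fine (w S) <= r * fine (w `]x1, x1 + delta[%classic) ->
  \int[w]_(x in S) (1 + xi * eta x) <= 2 * r.
Proof.
move=> x1_ge0 xi0 d0 r0 lK hm mS wS.
have hm2 : m * (lambda / eps) * K <= m * (1 / 2) by rewrite -mulrA ler_pM2l.
have mU : measurable (`]x1, x1 + delta[%classic : set R) by exact: measurable_itv.
have ax1 := density_ge0 x1.
have aS x : 1 + xi * eta x <= 2 * (1 + xi * eta x1).
  have := ler_wpM2l (ltW xi0) (es_ub ES x).
  have : xi * m <= xi * (2 * eta x1) by rewrite ler_pM2l//; lra.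
  by lra.
apply: (@le_trans _ _ (2 * (1 + xi * eta x1) * fine (w S))).
  by apply: Rintegral_le_cst => //; exact: integrable_affine_eigen_system.
rewrite -mulrA ler_pM2l//.
apply: (@le_trans _ _ ((1 + xi * eta x1) *
    (r * fine (w `]x1, x1 + delta[%classic)))); first by rewrite ler_wpM2l.
rewrite mulrCA ler_piMr//.
apply: (@le_trans _ _ (\int[w]_(x in `]x1, x1 + delta[) (1 + xi * eta x))).
  apply: Rintegral_ge_cst => //; first exact: integrable_affine_eigen_system.
  move=> x /=; rewrite in_itv/= => /andP[x1x _].
  by rewrite lerD2l ler_pM2l// ltW// (es_incr ES).
rewrite -[leRHS]Rintegral_density; apply: Rintegral_subset_le => //.
- exact: integrable_affine_eigen_system.
- by move=> x _; exact: density_ge0.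
Qed.

(** For negative [xi], the bound [eta >= - n] controls the density from above, and [xi >= - m^-1]
    caps it by 1 + n / m. *)
Lemma density_right_le : xi < 0 ->
  \int[w]_(x in [set x | 0 <= x]) (1 + xi * eta x) <=
  (1 + n / m) * fine (w [set x | 0 <= x]).
Proof.
move=> xi0; apply: Rintegral_le_cst; first exact: measurable_ge0.
  by apply: integrable_affine_eigen_system; exact: measurable_ge0.
move=> x _; rewrite lerD2l; have /andP[xim _] := hxi.
have := ler_wnM2l (ltW xi0) (es_lb ES x).
have : - xi * n <= m^-1 * n by rewrite ler_pM2r// lerNl.
by rewrite [m^-1 * n]mulrC; lra.
Qed.

End fixed_noise.

(** * Conditional expectations given an event *)

Section conditioning.
Context (R : realType) (w : probability (measurableTypeR R) R) (a : R -> R).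
Context d (Omega : measurableType d) (P : probability Omega R).
Context (X : Omega -> measurableTypeR R) (H : set Omega).
Hypothesis mX : measurable_fun [set: Omega] X.
Hypothesis mH : measurable H.
Hypothesis inta : w.-integrable [set: measurableTypeR R] (EFin \o a).

Lemma cond_expectation_indic (A : set (measurableTypeR R)) : measurable A ->
  cond_expectation w a P X H \1_A = cond_prob w a P X H A.
Proof.
move=> mA; rewrite /cond_expectation /cond_prob; case: ifPn => _.
  rewrite [RHS]Rintegral_mkcond; apply: eq_Rintegral => x _.
  by rewrite patch_indic mulrC.
congr (_ / _); rewrite /Rintegral; congr fine.
have mXA : measurable (X @^-1` A) by rewrite -[X in measurable X]setTI; exact: mX.
by rewrite -integral_indic.
Qed.

Hypothesis a0 : forall x, 0 <= a x.
Hypothesis a1 : \int[w]_x a x = 1.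

(** Both branches are instances of [weighted_mean_dist]: under [w] with weight [a] when [H] is null,
    otherwise under [P] on [H] with weight 1, followed by division by the probability of [H]. *)
Lemma cond_expectation_dist (g : R -> R) (A : set (measurableTypeR R))
    (B e v : R) :
  measurable A -> measurable_fun [set: measurableTypeR R] g ->
  (forall x, `|g x| <= B) -> `|v| <= B -> 0 <= e ->
  (forall x, A x -> `|g x - v| <= e) ->
  `|cond_expectation w a P X H g - v| <=
  e + 2 * B * cond_prob w a P X H (~` A).
Proof.
move=> mA mg gB vB e0 gv; rewrite /cond_expectation /cond_prob.
case: ifPn => [_|PH].
  have := @weighted_mean_dist _ _ _ w a g setT A B e v measurableT mA mg inta
    (fun x _ => a0 x) (fun x _ => gB x) vB e0 (fun x _ => @gv x).
  by rewrite a1 !mulr1 setTI.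
have mXA : measurable (X @^-1` A) by rewrite -[X in measurable X]setTI; exact: mX.
have PH0 : 0 < fine (P H).
  by rewrite fine_gt0// lt0e PH measure_ge0/= ltey_eq fin_num_measure.
have int1 : P.-integrable H (EFin \o cst (1 : R)).
  by apply: (@finite_measure_bounded_integrable _ _ _ _ _ _ `|1|).
have mgX : measurable_fun H (g \o X).
  by apply: measurable_funTS; exact: measurableT_comp.
have := @weighted_mean_dist _ _ _ P (cst 1) (g \o X) H (X @^-1` A) B e v mH mXA
  mgX int1 (fun x _ => ler01) (fun x _ => gB _) vB e0 (fun x _ => @gv _).
rewrite !Rintegral_cst//; last by apply: measurableI => //; exact: measurableC.
rewrite !mul1r; under eq_Rintegral do rewrite mulr1.
rewrite -preimage_setC setIC => h.
rewrite -[X in `|_ - X|](mulfK (lt0r_neq0 PH0)) -mulrBl normrM normfV.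
rewrite (gtr0_norm PH0) ler_pdivrMr// mulrDl mulrA divfK ?gt_eqF//.
Qed.

End conditioning.

Section near_zero.
Context {R : realType}.

Lemma near_right0_itv : \forall eps \near (0 : R)^'+, 0 < eps /\ eps <= 1.
Proof.
near=> eps; split; near: eps; first exact: nbhs_right_gt.
exact: nbhs_right_le.
Unshelve. all: by end_near. Qed.

Lemma cvg_exp_bound (f : R -> R) (C c : R) : 0 < c ->
  (forall eps, 0 < eps -> eps <= 1 -> 0 <= f eps <= C * expR (- (c / eps))) ->
  f eps @[eps --> 0^'+] --> (0 : R).
Proof.
move=> c0 fC; apply: (@squeeze_cvgr _ _ _ _ (fun=> 0)
  (fun eps => C * expR (- (c / eps)))).
- by apply: filterS near_right0_itv => eps [eps0 eps1]; exact: fC.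
- exact: cvg_cst.
- rewrite -[X in _ --> X](mulr0 C); apply: cvgM; first exact: cvg_cst.
  exact: expRN_inv_cvg0.
Qed.

Lemma near_cst_continuous (f : R -> R) (x v : R) :
  (\forall y \near x, f y = v) -> {for x, continuous f}.
Proof.
move=> fv; rewrite /prop_for /continuous_at (nbhs_singleton fv).
exact: cvg_near_cst.
Qed.

End near_zero.

(** * Passage to the limit in [eps] and the equivalences *)

Theorem theorem4p3 (R : realType) (F : continuousType R R) (x0 x1 : R)
  (hF : double_well F x0 x1)
  (lambda : R -> R) (eta : R -> R -> R) (xi p : R -> bool -> R)
  (hlambda : forall eps, 0 < eps -> second_eigenvalue F eps (- lambda eps))
  (heta : forall eps, 0 < eps ->
     eigenfunction F eps (- lambda eps) (eta eps) /\
     increasing_sign_change (eta eps))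
  (hxi : forall eps, 0 < eps -> admissible (eta eps) (xi eps))
  (hp : forall eps, 0 < eps ->
     (forall i, 0 <= p eps i) /\ \sum_i p eps i = 1)
  (d : R -> measure_display) (Omega : forall eps, measurableType (d eps))
  (P : forall eps, probability (Omega eps) R)
  (X : forall eps, R -> Omega eps -> R)
  (Y : forall eps, R -> Omega eps -> bool)
  (hXY : forall eps, 0 < eps ->
     coupled_process F eps (lambda eps) (eta eps) (xi eps) (p eps)
       (P eps) (X eps) (Y eps))
  (hlaw : forall (eps t : R) (j : bool) (G : set (measurableTypeR R)),
     0 < eps -> 0 <= t -> measurable G ->
     cond_prob (varpi F eps) (alpha (eta eps) (xi eps) j)
       (P eps) (X eps t) (Y eps t @^-1` [set j]) G =
     \int[varpi F eps]_(x in G) alpha (eta eps) (xi eps) j x) :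
  let condP (eps t : R) (j : bool) :=
    cond_prob (varpi F eps) (alpha (eta eps) (xi eps) j)
      (P eps) (X eps t) (Y eps t @^-1` [set j]) in
  let condE (eps t : R) (j : bool) :=
    cond_expectation (varpi F eps) (alpha (eta eps) (xi eps) j)
      (P eps) (X eps t) (Y eps t @^-1` [set j]) in
  let cond1 := forall t : R, 0 <= t ->
    condP eps t true [set x | 0 < x] @[eps --> 0^'+] --> (1 : R) in
  let conda :=
    (xi eps true / `|at_ninfty (eta eps)|^-1) @[eps --> 0^'+] --> (1 : R) in
  let condb := forall (t : R) (g : R -> R), 0 <= t ->
    bounded_fun g -> measurable_fun [set: measurableTypeR R] g ->
    {for x0, continuous g} -> {for x1, continuous g} ->
    (condE eps t true g -
      (\int[varpi F eps]_(x in [set x | 0 < x]) g x) /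
        fine (varpi F eps [set x | 0 < x])) @[eps --> 0^'+] --> (0 : R) in
  [/\ cond1 <-> conda, cond1 <-> condb &
      cond1 -> forall t : R, 0 <= t ->
        condP eps t false [set x | x < 0] @[eps --> 0^'+] --> (1 : R)].
Proof.
have x0_lt0 := dw_x0_lt0 hF; have x1_gt0 := dw_x1_gt0 hF.
pose n eps := - at_ninfty (eta eps); pose m eps := at_pinfty (eta eps).
pose w eps := varpi F eps.
pose L := [set x : R | x <= 0].
have ES eps : 0 < eps -> eigen_system F eps (lambda eps) (n eps) (m eps)
    (eta eps) (fun x => eps * expR (- F x / eps) * (eta eps)^`()%classic x).
  move=> eps0; have [l0 _ _] := hlambda _ eps0; rewrite oppr_lt0 in l0.
  by have [? ?] := heta _ eps0; exact: (eigen_system_eigenfunction hF).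
have n0 eps : 0 < eps -> 0 < n eps by move/ES/es_n.
have nE eps : 0 < eps -> `|at_ninfty (eta eps)| = n eps.
  by move=> /n0 ?; rewrite -normrN gtr0_norm.
have xiE eps j : 0 < eps -> - (m eps)^-1 <= xi eps j <= (n eps)^-1.
  by move=> eps0; have [h _] := hxi _ eps0; have := h j; rewrite nE.
have xi_neg eps : 0 < eps -> xi eps false * xi eps true < 0.
  by move=> eps0; have [_] := hxi _ eps0.
have mXY eps t : 0 < eps -> 0 <= t ->
    measurable_fun setT (X eps t : _ -> measurableTypeR R) /\
    forall j, measurable (Y eps t @^-1` [set j]).
  move=> eps0 t0; have [_ _ [K [_ [mZ _] _]]] := hXY _ eps0; split.
    exact: (measurableT_comp measurable_fst (mZ t t0)).
  move=> j; rewrite -[X in measurable X]setTI.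
  exact: (measurableT_comp measurable_snd (mZ t t0)).
have inta eps j A : 0 < eps -> measurable A ->
    (w eps).-integrable A (EFin \o alpha (eta eps) (xi eps) j).
  by move=> eps0 mA; exact: (integrable_affine_eigen_system (ES _ eps0)).
(* Some state [j] has positive probability at time 0, and its conditional law
   has total mass 1. *)
have mean0 eps : 0 < eps -> \int[w eps]_x eta eps x = 0.
  move=> eps0; have [_ mY] := mXY eps 0 eps0 (lexx _).
  have [j Pj] : exists j, P eps (Y eps 0 @^-1` [set j]) != 0%E.
    apply: contrapT => /forallNP h.
    have /negP := oner_neq0 R; apply; rewrite -eqe -(probability_setT (P eps)).
    rewrite (_ : setT = Y eps 0 @^-1` [set true] `|` Y eps 0 @^-1` [set false]).
      rewrite measureU//.
        have z j : P eps (Y eps 0 @^-1` [set j]) = 0%E.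
          by apply/eqP/negPn/negP; exact: h.
        by rewrite [X in (X + _)%E]z [X in (_ + X)%E]z adde0.
      by apply/seteqP; split => // o [/= -> ].
    by apply/seteqP; split => // o _ /=; case: (Y eps 0 o); [left|right].
  have := hlaw eps 0 j setT eps0 (lexx _) measurableT.
  rewrite /cond_prob (negbTE Pj) preimage_setT setTI divff; last first.
    by rewrite fine_eq0 ?fin_num_measure.
  rewrite (Rintegral_affine_eigen_system (ES _ eps0))// probability_setT mul1r.
  (* Total mass 1 says that [xi eps j] times the mean of [eta] is 0; the first factor is nonzero
     because the product of the two parameters is negative. *)
  move=> /eqP; rewrite addrC -subr_eq subrr eq_sym mulf_eq0 => /orP[/eqP xi0|/eqP//].
  have := xi_neg _ eps0; case: j xi0 {Pj} => ->; by rewrite ?mul0r ?mulr0 ltxx.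
have W1 : fine (w eps L) @[eps --> 0^'+] --> (1 : R).
  have [C [c [C0 c0 hC]]] := varpi_right_bound hF.
  have : 1 - fine (w eps L) @[eps --> 0^'+] --> (0 : R).
    apply: (@cvg_exp_bound _ _ C c c0) => eps eps0 eps1.
    have -> : 1 - fine (w eps L) = fine (w eps [set x | 0 < x]).
      rewrite (_ : [set x | 0 < x] = ~` L).
        rewrite probability_setC; last exact: measurable_le0.
        by rewrite fineB// fin_num_measure//; exact: measurable_le0.
      by apply/seteqP; split => x /=; rewrite ltNge => /negP.
    rewrite fine_ge0//=; apply: le_trans (hC _ eps0 eps1).
    rewrite -lee_fin !fineK ?fin_num_measure//;
      [|exact: measurable_ge0|exact: measurable_gt0].
    apply: le_measure; rewrite ?inE; [exact: measurable_gt0|exact: measurable_ge0|].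
    by move=> x /ltW.
  move/(cvgB (cvg_cst (1 : R))); rewrite subr0.
  by under eq_cvg do rewrite subKr.
(* Dividing by [n] makes the excess invariant under rescaling of the eigenfunction. *)
pose H eps := (\int[w eps]_(x in L) (n eps + eta eps x)) / n eps.
have H0 : H eps @[eps --> 0^'+] --> (0 : R).
  have [C [c [C0 c0 hC]]] := varpi_left_excess hF.
  apply: (@cvg_exp_bound _ _ C c c0) => eps eps0 eps1.
  have ESe := ES _ eps0; apply/andP; split.
    rewrite divr_ge0 ?(ltW (n0 _ eps0))//; apply: Rintegral_ge0 => x _.
    by have := es_lb ESe x; lra.
  rewrite ler_pdivrMr ?n0// mulrC; apply: (hC _ _ _ _ _ _ eps1 ESe).
  have -> : (fun x => n eps + eta eps x) = (fun x => n eps + 1 * eta eps x).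
    by apply/funext => x; rewrite mul1r.
  exact: (integrable_affine_eigen_system ESe (n eps) 1 (@measurable_le0 R)).
pose c eps := xi eps true / `|at_ninfty (eta eps)|^-1.
have cE eps : 0 < eps -> c eps = xi eps true * n eps.
  by move=> eps0; rewrite /c nE// invrK.
have leftE eps : 0 < eps ->
    \int[w eps]_(x in L) alpha (eta eps) (xi eps) true x =
    fine (w eps L) * (1 - c eps) + c eps * H eps.
  move=> eps0; rewrite (Rintegral_density_left (ES _ eps0)) cE//.
  by congr (_ + _); rewrite /H -mulrA [n eps * _]mulrC divfK ?gt_eqF ?n0//.
move=> condP condE cond1 conda condb.
(* An exact identity for each [eps]. Since the mass of [L] tends to 1 and [H] to 0, it links the
   limits of the conditional probability and of the ratio [c] in condition (a). *)
have PE eps t : 0 < eps -> 0 <= t ->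
    condP eps t true [set x | 0 < x] =
    1 - (fine (w eps L) * (1 - c eps) + c eps * H eps).
  move=> eps0 t0; rewrite /condP hlaw//; last exact: measurable_gt0.
  rewrite (Rintegral_density_setC (ES _ eps0))//; [|exact: mean0|exact: measurable_gt0].
  rewrite -leftE//; congr (1 - _); congr Rintegral.
  by apply/seteqP; split => x; rewrite /L/= leNgt => /negP.
have cond1a : cond1 -> conda.
  move=> /(_ 0 (lexx _)) h.
  (* This quotient is the identity [PE] solved for [c]; its denominator tends to 1. *)
  have : (condP eps 0 true [set x | 0 < x] - 1 + fine (w eps L)) /
      (fine (w eps L) - H eps) @[eps --> 0^'+] --> ((1 - 1 + 1) / (1 - 0) : R).
    apply: cvgM.
      by apply: cvgD => //; apply: cvgB => //; exact: cvg_cst.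
    by apply: cvgV; [rewrite subr0 oner_eq0|exact: cvgB].
  rewrite subrr add0r subr0 divr1; apply: cvg_trans; apply: near_eq_cvg.
  have WH : fine (w eps L) - H eps @[eps --> 0^'+] --> (1 - 0 : R) by exact: cvgB.
  near=> eps.
  have eps0 : 0 < eps by near: eps; exact: nbhs_right_gt.
  have d0 : 0 < fine (w eps L) - H eps.
    by near: eps; apply: (cvgr_gt _ WH); rewrite subr0.
  rewrite /= PE//.
  have -> : 1 - (fine (w eps L) * (1 - c eps) + c eps * H eps) - 1 +
      fine (w eps L) = c eps * (fine (w eps L) - H eps) by ring.
  by rewrite mulfK// gt_eqF.
have conda1 : conda -> cond1.
  move=> hc t t0.
  have : 1 - (fine (w eps L) * (1 - c eps) + c eps * H eps) @[eps --> 0^'+] -->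
      (1 - (1 * (1 - 1) + 1 * 0) : R).
    apply: cvgB; first exact: cvg_cst.
    apply: cvgD; last exact: cvgM.
    by apply: cvgM => //; apply: cvgB => //; exact: cvg_cst.
  rewrite subrr !mulr0 addr0 subr0; apply: cvg_trans; apply: near_eq_cvg.
  by apply: filterS near_right0_itv => eps [eps0 _]; rewrite PE.
have xi_gt0 : conda -> \forall eps \near 0^'+, 0 < xi eps true.
  move=> hc; near=> eps.
  have eps0 : 0 < eps by near: eps; exact: nbhs_right_gt.
  have : 0 < c eps by near: eps; apply: (cvgr_gt _ hc).
  by rewrite cE// pmulr_lgt0// n0.
have w_gt0 eps : 0 < eps -> eps <= 1 -> 0 < fine (w eps [set x | 0 < x]).
  move=> eps0 eps1; rewrite /w (varpiE hF)//; last exact: measurable_gt0.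
  rewrite divr_gt0 ?(gibbs_massT_gt0 hF)//.
  apply: lt_le_trans (gibbs_mass_gt0 hF eps0 eps1 (@ltr01 R)) _.
  apply: (le_gibbs_mass hF) => //; first exact: measurable_gt0.
  by move=> x /=; rewrite in_itv/= => /andP[].
split.
- by split.
- split; last first.
    (* The indicator of the right half-line is discontinuous only at 0, hence allowed in (b); its
       mean under [varpi] given that half-line is 1. *)
    move=> hb t t0; pose g : R -> R := \1_[set x : R | 0 < x].
    have gx0 : {for x0, continuous g}.
      apply: (near_cst_continuous (v := 0)).
      apply: filterS (lt_nbhsl x0_lt0) => x x_lt0.
      by rewrite /g indicE memNset//= ltNge ltW.
    have gx1 : {for x1, continuous g}.
      apply: (near_cst_continuous (v := 1)).
      by apply: filterS (lt_nbhsr x1_gt0) => x x_gt0; rewrite /g indicE mem_set.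
    have gb : bounded_fun g.
      exists 1; split; first exact: num_real.
      by move=> M M1 x _ /=; rewrite /g indicE; case: (_ \in _);
        rewrite ?normr1 ?normr0 ltW// (lt_trans ltr01).
    have mg : measurable_fun [set: measurableTypeR R] g.
      by apply: measurable_indic; exact: measurable_gt0.
    have /(cvgD (cvg_cst (1 : R))) := hb t g t0 gb mg gx0 gx1.
    rewrite addr0; apply: cvg_trans; apply: near_eq_cvg.
    apply: filterS near_right0_itv => eps [eps0 eps1].
    have [mX mY] := mXY eps t eps0 t0.
    suff : 1 + (condE eps t true g - (\int[w eps]_(x in [set x | 0 < x]) g x) /
      fine (w eps [set x | 0 < x])) = condP eps t true [set x | 0 < x] by [].
    have -> : condE eps t true g = condP eps t true [set x | 0 < x].
      by apply: cond_expectation_indic => //; exact: measurable_gt0.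
    rewrite [X in X / _](_ : _ = fine (w eps [set x | 0 < x])); last first.
      rewrite -[RHS]mul1r -Rintegral_cst; last exact: measurable_gt0.
      by apply: eq_Rintegral => x xA; rewrite /g indicE xA.
    by rewrite divff ?gt_eqF ?w_gt0// addrC subrK.
  move=> h1 t g t0 [B0 [_ gB0]] mg gx0 gx1.
  have hca := cond1a h1.
  pose B := `|B0| + 1.
  have B_gt0 : 0 < B by rewrite ltr_wpDl.
  have gB x : `|g x| <= B by apply: gB0 => //; rewrite /B ltr_pwDr// ler_norm.
  (* Both conditional means are compared with [v]: each of the two laws concentrates at [x1]. *)
  pose v := g x1.
  apply/cvgr0Pnorm_lt => e e0.
  have e40 : 0 < e / 4 by rewrite divr_gt0.
  have [delta0 /= delta00 hdelta] : exists2 delta, 0 < delta &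
      forall x, `|x - x1| < delta -> `|g x - v| <= e / 4.
    have /cvgrPdist_le/(_ _ e40)/nbhs_ballP[delta /= d0 hd] := gx1.
    exists delta => // x xd; rewrite distrC; apply: hd.
    by rewrite /ball/= distrC.
  (* Continuity at [x1] needs [delta <= delta0]; the strict minimum on the right half-line needs
     [delta <= x1 / 2]. *)
  pose delta := Num.min delta0 (x1 / 2).
  have d0 : 0 < delta by rewrite lt_min delta00 divr_gt0.
  have dx1 : delta <= x1 / 2 by rewrite ge_min lexx orbT.
  have [C1 [c1 [C10 c10 hconc]]] := varpi_right_concentration hF d0 dx1.
  have [C2 [c2 [K [C20 c20 K0 hest]]]] := double_well_eigen_estimates hF.
  pose r eps := C1 * expR (- (c1 / eps)).
  pose A := [set x : R | `|x - x1| < delta].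
  pose S := [set x : R | 0 < x /\ delta <= `|x - x1|].
  have mA : measurable A.
    rewrite (_ : A = `]x1 - delta, x1 + delta[%classic); first exact: measurable_itv.
    by apply/seteqP; split => x; rewrite /A/= in_itv/= ltr_distl.
  have mS : measurable S.
    rewrite (_ : S = [set x : R | 0 < x] `&` ~` A).
      by apply: measurableI; [exact: measurable_gt0|exact: measurableC].
    by apply/seteqP; split => x; rewrite /S /A/= leNgt => -[? /negP ?].
  have r0 : r eps @[eps --> 0^'+] --> (0 : R).
    by apply: (@cvg_exp_bound _ _ C1 c1 c10) => eps _ _; rewrite lexx andbT
      mulr_ge0 ?expR_ge0// ltW.
  have lK0 : C2 * expR (- (c2 / eps)) * K @[eps --> 0^'+] --> (0 : R).
    rewrite -[X in _ --> X](mul0r K); apply: cvgM; last exact: cvg_cst.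
    by apply: (@cvg_exp_bound _ _ C2 c2 c20) => eps _ _; rewrite lexx andbT
      mulr_ge0 ?expR_ge0// ltW.
  (* The sum of the two contributions from outside [A], to be made smaller than [e / 2]; the
     oscillation of [g] on [A] costs [e / 4] for each mean. *)
  have tot0 : 2 * B * (1 - condP eps t true [set x | 0 < x] + 2 * r eps)
      + 2 * B * r eps @[eps --> 0^'+] --> (0 : R).
    rewrite -[X in _ --> X](_ : 2 * B * (1 - 1 + 2 * 0) + 2 * B * 0 = 0);
      last by ring.
    apply: cvgD; (apply: cvgM; first exact: cvg_cst) => //.
    apply: cvgD; last by apply: cvgM => //; exact: cvg_cst.
    by apply: cvgB; [exact: cvg_cst|exact: h1].
  have xi0 := xi_gt0 hca.
  near=> eps.
  have eps0 : 0 < eps by near: eps; exact: nbhs_right_gt.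
  have eps1 : eps <= 1 by near: eps; exact: nbhs_right_le.
  have xi1 : 0 < xi eps true by near: eps.
  have ESe := ES _ eps0.
  have [mX mY] := mXY eps t eps0 t0.
  have [hl _ hm _] := hest _ _ _ _ _ _ eps1 ESe.
  have lK : lambda eps / eps * K <= 1 / 2.
    apply: (@le_trans _ _ (C2 * expR (- (c2 / eps)) * K)); first by rewrite ler_pM2r.
    by near: eps; apply: (cvgr_le _ lK0); rewrite divr_gt0.
  have r_ge0 : 0 <= r eps by rewrite mulr_ge0 ?expR_ge0// ltW.
  have tot : 2 * B * (1 - condP eps t true [set x | 0 < x] + 2 * r eps)
      + 2 * B * r eps < e / 2.
    by near: eps; apply: (cvgr_lt _ tot0); rewrite divr_gt0.
  have wS : fine (w eps S) <= r eps * fine (w eps `]x1, x1 + delta[%classic).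
    exact: hconc.
  have a0 := density_ge0 ESe (xiE eps true eps0).
  have gA x : A x -> `|g x - v| <= e / 4.
    by move=> Ax; apply: hdelta; rewrite (lt_le_trans Ax)// ge_min lexx.
  (* The complement of [A] is covered by the nonpositive half-line, controlled by (1), and by [S],
     controlled by the density bound. *)
  have condA : condP eps t true (~` A) <=
      1 - condP eps t true [set x | 0 < x] + 2 * r eps.
    rewrite /condP !hlaw//; [|exact: measurable_gt0|exact: measurableC].
    rewrite (Rintegral_density_setC ESe _ (mean0 _ eps0) measurable_gt0) subKr.
    have aS : \int[w eps]_(x in S) (1 + xi eps true * eta eps x) <= 2 * r eps.
      exact: (density_right_concentration ESe (xiE eps true eps0) (mean0 _ eps0)
        (ltW x1_gt0) xi1 d0 r_ge0 lK hm mS wS).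
    have mC : measurable (~` [set x : R | 0 < x]).
      by apply: measurableC; exact: measurable_gt0.
    apply: (@le_trans _ _ (\int[w eps]_(x in ~` [set x | 0 < x] `|` S)
        (1 + xi eps true * eta eps x))).
      apply: Rintegral_subset_le => //.
      - exact: measurableC.
      - exact: measurableU.
      - move=> x; rewrite /A/= => /negP; rewrite -leNgt => dx.
        by have [x_gt0|x_le0] := ltP 0 x; [right|left].
      - by apply: inta => //; exact: measurableU.
      - by move=> x _; exact: a0.
    rewrite Rintegral_setU//; first by rewrite lerD2l.
      by apply: inta => //; exact: measurableU.
    by apply/disj_setPS => x [/= ? []].
  have dE : `|condE eps t true g - v| <= e / 4 + 2 * B * condP eps t true (~` A).
    exact: (cond_expectation_dist _ mX (mY true) (inta eps true _ eps0 measurableT)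
      a0 (Rintegral_density ESe _ (mean0 _ eps0)) mA mg gB (gB x1) (ltW e40) gA).
  have wpos := w_gt0 _ eps0 eps1.
  (* Here the weight is constant, and the window of [wS] lies in the right half-line, so [S] has
     relative mass at most [r eps]. *)
  have dR : `|(\int[w eps]_(x in [set x | 0 < x]) g x) /
      fine (w eps [set x | 0 < x]) - v| <= e / 4 + 2 * B * r eps.
    have int1 : (w eps).-integrable [set x | 0 < x] (EFin \o cst (1 : R)).
      apply: (@finite_measure_bounded_integrable _ _ _ _ _ _ `|1|) => //.
      exact: measurable_gt0.
    have := @weighted_mean_dist _ _ _ (w eps) (cst 1) g [set x | 0 < x] A B
      (e / 4) v measurable_gt0 mA (measurable_funTS mg) int1 (fun x _ => ler01)
      (fun x _ => gB x) (gB x1) (ltW e40) (fun x _ => @gA x).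
    rewrite (_ : [set x : R | 0 < x] `&` ~` A = S); last first.
      by apply/seteqP; split => x; rewrite /S /A/= leNgt => -[? /negP ?].
    rewrite !Rintegral_cst//; last exact: measurable_gt0.
    rewrite !mul1r; under eq_Rintegral do rewrite mulr1.
    move=> h; rewrite -[X in `|_ - X|](mulfK (lt0r_neq0 wpos)) -mulrBl normrM normfV.
    rewrite (gtr0_norm wpos) ler_pdivrMr//; apply: (le_trans h).
    rewrite [leRHS]mulrDl lerD2l -[leRHS]mulrA.
    rewrite ler_wpM2l ?mulr_ge0 ?(ltW B_gt0)// (le_trans wS)// ler_wpM2l//.
    rewrite -lee_fin !fineK ?fin_num_measure//; last exact: measurable_gt0.
    apply: le_measure; rewrite ?inE; [exact: measurable_itv|exact: measurable_gt0|].
    by move=> x /=; rewrite in_itv/= => /andP[+ _]; exact: lt_trans.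
  have BA : 2 * B * condP eps t true (~` A) <=
      2 * B * (1 - condP eps t true [set x | 0 < x] + 2 * r eps).
    by rewrite ler_wpM2l ?mulr_ge0 ?(ltW B_gt0).
  have := ler_distD v (condE eps t true g)
    ((\int[w eps]_(x in [set x | 0 < x]) g x) / fine (w eps [set x | 0 < x])).
  rewrite (distrC v) => tri; apply: (le_lt_trans tri).
  by apply: le_lt_trans (lerD dE dR) _; lra.
- move=> h1 t t0; have hca := cond1a h1.
  have xi0 := xi_gt0 hca.
  have [C [c' [C0 c0 hC]]] := varpi_right_bound hF.
  have WH : fine (w eps L) - H eps @[eps --> 0^'+] --> (1 - 0 : R) by exact: cvgB.
  (* The constant 3 bounds 1 + n / m, once n <= 2 m is known. *)
  have : 1 - 3 * (C * expR (- (c' / eps))) @[eps --> 0^'+] --> (1 - 3 * 0 : R).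
    apply: cvgB; first exact: cvg_cst.
    apply: cvgM; first exact: cvg_cst.
    by apply: (@cvg_exp_bound _ _ C c' c0) => eps _ _; rewrite lexx andbT
      mulr_ge0 ?expR_ge0// ltW.
  rewrite mulr0 subr0 => lo.
  apply: (@squeeze_cvgr _ _ _ _
    (fun eps => 1 - 3 * (C * expR (- (c' / eps)))) (fun=> 1)) => //; last first.
    exact: cvg_cst.
  near=> eps.
  have eps0 : 0 < eps by near: eps; exact: nbhs_right_gt.
  have eps1 : eps <= 1 by near: eps; exact: nbhs_right_le.
  have xi1 : 0 < xi eps true by near: eps.
  have ESe := ES _ eps0.
  have half : 1 / 2 < fine (w eps L) - H eps.
    by near: eps; apply: (cvgr_gt _ WH); lra.
  have xif : xi eps false < 0.
    by have := xi_neg _ eps0; rewrite pmulr_llt0.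
  rewrite /condP hlaw//; last exact: measurable_lt0.
  rewrite (Rintegral_density_setC ESe _ (mean0 _ eps0) measurable_lt0).
  rewrite (_ : ~` [set x : R | x < 0] = [set x : R | 0 <= x]); last first.
    by apply/seteqP; split => x; rewrite /= leNgt => /negP.
  rewrite gerBl lerD2l lerN2; apply/andP; split; last first.
    by apply: Rintegral_ge0 => x _; exact: (density_ge0 ESe (xiE eps false eps0)).
  apply: le_trans (density_right_le ESe (xiE eps false eps0) xif) _.
  apply: ler_pM; [|exact: fine_ge0| |exact: hC].
    by rewrite addr_ge0// divr_ge0// ltW// ?(es_n ESe)// (es_m ESe).
  (* [eigen_system_balance] divided by [n] reads w(L) - H <= m / n, and the left side exceeds 1 / 2
     for small [eps]. *)
  have : n eps <= 2 * m eps.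
    have := eigen_system_balance ESe (mean0 _ eps0).
    have -> : \int[varpi F eps]_(x in [set x | x <= 0]) (n eps + eta eps x) =
        n eps * H eps by rewrite /H mulrC divfK// gt_eqF ?n0.
    rewrite -/L -/(w eps) -mulrBr.
    have := ltr_pM2l (n0 _ eps0) (1 / 2) (fine (w eps L) - H eps).
    rewrite half; lra.
  rewrite -ler_pdivrMr ?(es_m ESe)//; lra.
Unshelve. all: by end_near.
Qed.
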